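(* Let $(X,\|\cdot\|)$ be a complex finite-dimensional Banach space and let $A$ be a (bounded) linear operator on $X$. Then, for each bounded weak solution $y(\cdot)$ of the equation $y'(t)=Ay(t)$, $t\ge 0$, $$\lim_{t\to\infty}\frac{1}{t}\int_0^t y(s)\,ds=P(0,A)y(0),$$ where $P(0,A)$ is the spectral projection of $A$ at $0$. If, moreover, the spectrum of $A$ contains no pure imaginary values, then, for each bounded weak solution $y(\cdot)$ of this equation, $$\lim_{t\to\infty}y(t)=P(0,A)y(0).$$
   Context: A weak solution of $y'(t)=Ay(t)$, $t\ge0$, is a norm-continuous function $y:[0,\infty)\to X$ such that, for all $t\ge 0$, $\int_0^t y(s)\,ds$ lies in the domain of $A$ (here all of $X$) and $y(t)=y(0)+A\int_0^t y(s)\,ds$; in the finite-dimensional setting the weak solutions are exactly the classical (differentiable) ones. It is bounded if $\sup_{t\ge0}\|y(t)\|<\infty$. The dimension of $X$ is at least $1$. For $\lambda\in\mathbb{C}$, the spectral (Riesz) projection of $A$ at $\lambda$ is $$P(\lambda,A)=-\frac{1}{2\pi i}\int_\gamma (A-zI)^{-1}\,dz,$$ where $\gamma$ is a positively oriented rectifiable Jordan contour enclosing $\lambda$ which, along with its interior, except possibly for $\lambda$ itself, is contained in the resolvent set of $A$. In particular, $P(\lambda,A)=0$ if and only if $\lambda$ is not an eigenvalue of $A$. ''Pure imaginary values'' are the elements of $i\mathbb{R}\setminus\{0\}$ (so $0$ is allowed to be in the spectrum). *)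

(* Defs.v *)
From HB Require Import structures.
From mathcomp Require Import all_boot all_order all_algebra.
From mathcomp Require Import complex.
From mathcomp Require Import all_classical all_reals all_analysis.

Set Implicit Arguments.
Unset Strict Implicit.
Unset Printing Implicit Defensive.

Import Order.TTheory GRing.Theory Num.Theory.
Import numFieldNormedType.Exports.

#[global] Open Scope classical_set_scope.
#[global] Open Scope complex_scope.
#[global] Open Scope ring_scope.

(* R[i] with the topology of its modulus, as a normed space over itself.
   Norms over R[i] take their values in the nonnegative reals of R[i]. *)
HB.instance Definition _ (R : realType) := NormedModule.copy R[i] (R[i])^o.

Section FiniteDimension.
Variables (R : realType) (X : lmodType R[i]).

Definition is_basis n (e : 'I_n -> X) :=
  forall x : X, exists! c : 'rV[R[i]]_n, x = \sum_i c 0 i *: e i.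

End FiniteDimension.

Section Integrals.
Variable R : realType.

(* a :: s subdivides [a, b] into intervals of length less than delta, and
   xi j is a point of the j-th of them. *)
Definition tagged_partition (a b delta : R) (s : seq R) (xi : nat -> R) :=
  itv_partition a b s /\
  forall j, (j < size s)%N ->
    [/\ nth b (a :: s) j.+1 - nth b (a :: s) j < delta,
        nth b (a :: s) j <= xi j & xi j <= nth b (a :: s) j.+1].

Definition RS_sum (V : lmodType R[i]) (a b : R) (g : R -> R[i]) (f : R -> V)
    (s : seq R) (xi : nat -> R) : V :=
  \sum_(0 <= j < size s)
    (g (nth b (a :: s) j.+1) - g (nth b (a :: s) j)) *: f (xi j).

(* Riemann-Stieltjes integral of f with respect to g over [a, b]. *)
Definition is_RS_integral (V : normedModType R[i]) (a b : R) (g : R -> R[i])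
    (f : R -> V) (v : V) :=
  forall eps : R, 0 < eps -> exists2 delta : R, 0 < delta &
    forall s xi, tagged_partition a b delta s xi ->
      `|RS_sum a b g f s xi - v| <= eps%:C.

(* The same for operator-valued F, the limit being in the operator norm. *)
Definition is_RS_integral_op (V : normedModType R[i]) (a b : R)
    (g : R -> R[i]) (F : R -> V -> V) (J : V -> V) :=
  forall eps : R, 0 < eps -> exists2 delta : R, 0 < delta &
    forall s xi, tagged_partition a b delta s xi ->
      forall x, `|RS_sum a b g (F^~ x) s xi - J x| <= eps%:C * `|x|.

(* The Riemann integral over [a, b]; 0 if it does not exist. *)
Definition riemann_int (V : normedModType R[i]) (a b : R) (f : R -> V) : V :=
  xget 0 (is_RS_integral a b (fun t => t%:C) f).

End Integrals.

Section Contours.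
Variable R : realType.
Implicit Type gamma : R -> R[i].

Definition rectifiable gamma :=
  exists M : R, forall s, itv_partition 0 1 s ->
    \sum_(0 <= j < size s)
      `|gamma (nth 1 (0 :: s) j.+1) - gamma (nth 1 (0 :: s) j)| <= M%:C.

Definition contour_trace gamma : set R[i] := gamma @` `[0, 1].

Definition jordan_contour gamma :=
  [/\ {within `[0, 1], continuous gamma}, gamma 0 = gamma 1,
      {in `[0, 1[ &, injective gamma} & rectifiable gamma].

(* The bounded part of the complement of the contour. *)
Definition inside gamma : set R[i] :=
  [set z | ~ contour_trace gamma z /\
           bounded_set (connected_component (~` contour_trace gamma) z)].

(* The winding number around each interior point is 1. *)
Definition positively_oriented gamma :=
  forall z, inside gamma z ->
    is_RS_integral 0 1 gamma (fun t => (gamma t - z)^-1) (2 * pi%:C * 'i).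

End Contours.

Section Spectrum.
Variables (R : realType) (X : normedModType R[i]) (A : X -> X).

(* B is the bounded linear operator (A - z I)^-1. *)
Definition is_resolvent (z : R[i]) (B : X -> X) :=
  [/\ linear B, continuous B,
      cancel (fun x => A x - z *: x) B & cancel B (fun x => A x - z *: x)].

Definition resolvent_set : set R[i] := [set z | exists B, is_resolvent z B].

Definition spectrum : set R[i] := ~` resolvent_set.

Definition resolvent (z : R[i]) : X -> X := xget (fun=> 0) (is_resolvent z).

Definition isolating_contour (lambda : R[i]) (gamma : R -> R[i]) :=
  [/\ jordan_contour gamma, positively_oriented gamma, inside gamma lambda,
      contour_trace gamma `<=` resolvent_set &
      inside gamma `\ lambda `<=` resolvent_set].

Definition is_spectral_projection (lambda : R[i]) (P : X -> X) :=
  exists gamma J,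
    [/\ isolating_contour lambda gamma,
        is_RS_integral_op 0 1 gamma (resolvent \o gamma) J &
        P = fun x => - (2 * pi%:C * 'i)^-1 *: J x].

Definition spectral_projection (lambda : R[i]) : X -> X :=
  xget (fun=> 0) (is_spectral_projection lambda).

Definition weak_solution (y : R -> X) :=
  {within `[0, +oo[, continuous y} /\
  forall t, 0 <= t -> y t = y 0 + A (riemann_int 0 t y).

End Spectrum.

Definition bounded_on_halfline (R : realType) (X : normedModType R[i])
  (y : R -> X) := bounded_set (y @` `[0, +oo[).

(* Main.v *)
Require Import Defs.
From HB Require Import structures.
From mathcomp Require Import all_boot all_order all_algebra.
From mathcomp Require Import complex.
From mathcomp Require Import all_classical all_reals all_analysis.
From mathcomp Require Import ring lra.
Import Order.TTheory GRing.Theory Num.Theory.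
Import numFieldNormedType.Exports.

(** The space is the sum of the root spaces [ker (A - mu)^k] of [A], and both
    limits can be checked on one root space at a time.  For this the bounded
    solutions themselves are decomposed: they form a vector space of functions
    which the operator [y |-> A \o y] maps to itself, and a product of factors
    [A - mu] that vanishes on the space also vanishes on these functions.  So
    every bounded solution is a sum of bounded solutions [y] such that
    [(A - mu)^k y = 0] for some [mu] and [k] ([solution_root_span]), and as the
    two sides of the limits are additive, only such [y] matter.

    The projection.  If [(A - mu)^k v = 0], the resolvent at [zeta], applied to
    [v], is a polynomial in [(zeta - mu)^-1] without constant term.  The powers
    with exponent at least [2] have primitives, so the integral over a closed
    contour only sees the winding number around [mu]
    ([resolvent_root_integral]).  It is [1] for [mu = 0].  An eigenvalue
    [mu != 0] is not enclosed, and then the integral of [(zeta - mu)^-1] is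
    zero: it is locally constant in [mu], so constant on a component of the
    complement of the contour, and it tends to zero at infinity in an unbounded
    component ([outside_vanishing]).  Hence the projection fixes the root
    vectors of [0] and kills those of every other [mu], whatever the contour
    ([spectral_projection_root]).  That some contour has all the required
    properties is shown by a small circle around the origin
    ([exists_isolating_circle]).

    The solutions.  If [mu != 0], then [A] is invertible on the root space and
    [y = A \o u] for a bounded solution [u]; the integral of [y] is
    [u t - u 0], which is bounded, so the means tend to zero ([mean_root]).  If
    [mu = 0], then [y] is a polynomial in [t]; being bounded, it is constant
    ([nilpotent_solution_const]).  For the convergence of [y] itself, the
    hypothesis on the spectrum leaves [mu = 0], where [y] is constant, and the
    [mu] with non-zero real part, where [y] tends to zero: by induction on [k],
    [y' = mu y + z] with [z] tending to zero, so that over short times the norm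
    of [y] contracts or expands at the rate [Re mu] up to a small error, and
    boundedness leaves only decay to zero ([solution_decay]).

    In finite dimension the coordinates are bounded by the norm
    ([coord_bounded]); this makes linear maps bounded, and it yields the
    integrals of continuous functions from those of their coordinates. *)

Set Implicit Arguments.
Unset Strict Implicit.
Unset Printing Implicit Defensive.
Local Open Scope classical_set_scope.
Local Open Scope ring_scope.

(** * Real-valued norms *)

Section LinearFun.
Variables (K : pzRingType) (U V : lmodType K) (f : U -> V).
Hypothesis f_linear : linear f.

Lemma lin0 : f 0 = 0.
Proof. by have := f_linear (-1) 0 0; rewrite scaler0 addr0 scaleN1r addNr. Qed.

Lemma linD x y : f (x + y) = f x + f y.
Proof. by rewrite -[x]scale1r f_linear !scale1r. Qed.

Lemma linZ a x : f (a *: x) = a *: f x.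
Proof. by rewrite -[a *: x]addr0 f_linear lin0 addr0. Qed.

Lemma linB x y : f (x - y) = f x - f y.
Proof. by rewrite -scaleN1r linD linZ scaleN1r. Qed.

Lemma lin_sum (I : Type) (r : seq I) (P : pred I) (F : I -> U) :
  f (\sum_(i <- r | P i) F i) = \sum_(i <- r | P i) f (F i).
Proof. exact: (big_morph f linD lin0). Qed.

End LinearFun.

Section RealNorm.
Variables (R : realType) (V : normedModType R[i]).
Implicit Types x y : V.

(** [`|x|] is a complex number without imaginary part; its real part carries
    the same information and is open to real arithmetic. *)
Definition rnorm x : R := complex.Re `|x|.

Lemma rnormE x : `|x| = (rnorm x)%:C.
Proof. by rewrite /rnorm RRe_real // normr_real. Qed.

Lemma rnorm_ge0 x : 0 <= rnorm x.
Proof. by rewrite -lecR -rnormE normr_ge0. Qed.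

Lemma rnorm0 : rnorm 0 = 0.
Proof. by rewrite /rnorm normr0. Qed.

Lemma rnorm_eq0 x : rnorm x = 0 -> x = 0.
Proof. by move=> x0; apply/normr0_eq0; rewrite rnormE x0. Qed.

Lemma rnormN x : rnorm (- x) = rnorm x.
Proof. by rewrite /rnorm normrN. Qed.

Lemma rnormD x y : rnorm (x + y) <= rnorm x + rnorm y.
Proof. by rewrite -lecR rmorphD /= -!rnormE ler_normD. Qed.

Lemma rnormB x y : rnorm (x - y) <= rnorm x + rnorm y.
Proof. by rewrite -(rnormN y); exact: rnormD. Qed.

Lemma rdistC x y : rnorm (x - y) = rnorm (y - x).
Proof. by rewrite -rnormN opprB. Qed.

Lemma rnorm_sum (I : Type) (r : seq I) (P : pred I) (F : I -> V) :
  rnorm (\sum_(i <- r | P i) F i) <= \sum_(i <- r | P i) rnorm (F i).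
Proof.
elim/big_rec2: _ => [|i a b _ ab]; first by rewrite rnorm0.
by rewrite (le_trans (rnormD _ _))// lerD2l.
Qed.

End RealNorm.

Section RealNormScale.
Variable R : realType.

Lemma rnormZ (V : normedModType R[i]) (a : R[i]) (x : V) :
  rnorm (a *: x) = rnorm a * rnorm x.
Proof. by apply: complexI; rewrite rmorphM /= -!rnormE normrZ. Qed.

Lemma rnormM (a b : R[i]) : rnorm (a * b) = rnorm a * rnorm b.
Proof. exact: (rnormZ a b). Qed.

Lemma rnormX (a : R[i]) n : rnorm (a ^+ n) = rnorm a ^+ n.
Proof. by apply: complexI; rewrite rmorphXn /= -!rnormE normrX. Qed.

Lemma rnormV (a : R[i]) : rnorm a^-1 = (rnorm a)^-1.
Proof. by apply: complexI; rewrite fmorphV /= -!rnormE normfV. Qed.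

Lemma rnormC (a : R) : rnorm (a%:C : R[i]) = `|a|.
Proof. by rewrite /rnorm normc_def /= expr0n addr0 sqrtr_sqr. Qed.

Lemma rnormZC (V : normedModType R[i]) (a : R) (x : V) :
  rnorm (a%:C *: x) = `|a| * rnorm x.
Proof. by rewrite rnormZ rnormC. Qed.

Lemma Re_le_rnorm (a : R[i]) : `|complex.Re a| <= rnorm a.
Proof. by rewrite -lecR -rnormE normc_ge_Re. Qed.

Lemma Im_le_rnorm (a : R[i]) : `|complex.Im a| <= rnorm a.
Proof.
by rewrite /rnorm normc_def /= -sqrtr_sqr ler_wsqrtr// lerDr sqr_ge0.
Qed.

Lemma rnorm_le_ReIm (a : R[i]) :
  rnorm a <= `|complex.Re a| + `|complex.Im a|.
Proof.
rewrite [a in rnorm a]complexE (le_trans (rnormD _ _))// rnormM rnormC.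
by rewrite rnormC lerD2l /rnorm normc_def /= expr0n expr1n add0r sqrtr1 mul1r.
Qed.

Lemma rnorm_sqr (a : R[i]) :
  rnorm a ^+ 2 = complex.Re a ^+ 2 + complex.Im a ^+ 2.
Proof.
by rewrite /rnorm normc_def /= sqr_sqrtr// addr_ge0 ?sqr_ge0.
Qed.

Lemma cvg_rnormP (T : Type) (F : set_system T) (FF : Filter F)
    (V : normedModType R[i]) (f : T -> V) (l : V) :
  f @ F --> l <-> (forall e : R, 0 < e -> \forall t \near F, rnorm (f t - l) < e).
Proof.
split=> [/cvgrPdist_lt fl e e0|fl].
  have := fl e%:C; rewrite ltcR => /(_ e0); apply: filterS => t.
  by rewrite rnormE ltcR rdistC.
apply/cvgrPdist_lt => e e0.
have eR : e = (complex.Re e)%:C by rewrite RRe_real// gtr0_real.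
rewrite eR; rewrite eR ltcR in e0.
by apply: filterS (fl _ e0) => t; rewrite rnormE ltcR rdistC.
Qed.

Lemma bounded_rnormP (V : normedModType R[i]) (A : set V) :
  bounded_set A <-> exists M : R, forall x, A x -> rnorm x <= M.
Proof.
split=> [[M [Mr hM]]|[M hM]].
  exists (complex.Re M + 1) => x Ax; rewrite -lecR -rnormE.
  apply: (hM _ _ x Ax); rewrite -[M in M < _](RRe_real Mr) ltcR.
  by rewrite ltrDl.
exists M%:C; split; first by apply/complex_realP; exists M.
move=> z Mz x Ax; rewrite /= rnormE; apply: le_trans (ltW Mz).
by rewrite lecR hM.
Qed.

End RealNormScale.

(** * Riemann-Stieltjes integrals *)

Section Partitions.
Variable R : realType.
Implicit Types (a b : R) (s : seq R).

Lemma partition_point a b s j : itv_partition a b s -> (j <= size s)%N ->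
  a <= nth b (a :: s) j <= b.
Proof.
move=> sab js.
by rewrite itv_partition_nth_ge ?itv_partition_nth_le.
Qed.

Lemma partition_step a b s j : itv_partition a b s -> (j < size s)%N ->
  nth b (a :: s) j < nth b (a :: s) j.+1.
Proof. by move=> [/(pathP b) sab _] js; exact: sab. Qed.

Lemma partition_telescope (V : zmodType) (F : R -> V) a b s :
  itv_partition a b s ->
  \sum_(0 <= j < size s) (F (nth b (a :: s) j.+1) - F (nth b (a :: s) j)) =
  F b - F a.
Proof.
move=> sab; rewrite (telescope_sumr (fun j => F (nth b (a :: s) j)))//=.
by rewrite (itv_partition_nth_size b sab).
Qed.

(** Steps of length [d / 2] from [a], until [b] is closer than [d]. *)
Lemma fine_partition a b d : a <= b -> 0 < d ->
  exists2 s, itv_partition a b s & forall j, (j < size s)%N ->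
    nth b (a :: s) j.+1 - nth b (a :: s) j < d.
Proof.
move=> ab d0.
have [N] : exists N : nat, b - a <= N%:R * (d / 2).
  exists (Num.truncn ((b - a) / (d / 2))).+1.
  by rewrite -ler_pdivrMr ?divr_gt0// ltW// truncnS_gt.
elim: N a ab => [|N IH] a ab baN.
  have -> : a = b by apply/eqP; rewrite eq_le ab/=; lra.
  by exists [::].
move: ab; rewrite le_eqVlt => /predU1P[->|ab]; first by exists [::].
have [bad|dba] := ltP (b - a) d.
  by exists [:: b]; [exact: itv_partition1|case].
have a'b : a + d / 2 < b by lra.
have [||s sp sd] := IH (a + d / 2); first exact: ltW.
  by move: baN; rewrite -natr1 mulrDl mul1r; lra.
exists (a + d / 2 :: s).
  have [p l] := sp; split => //=; rewrite p andbT ltrDl; lra.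
by case=> [_|j js] /=; [lra|exact: sd].
Qed.

End Partitions.

Section RiemannStieltjes.
Variable R : realType.
Implicit Types (a b : R) (g : R -> R[i]).

Lemma exists_tagged_partition a b d : a <= b -> 0 < d ->
  exists s xi, tagged_partition a b d s xi.
Proof.
move=> ab d0; have [s sab sd] := fine_partition ab d0.
exists s, (nth b (a :: s)); split => // j js.
by rewrite sd// lexx ltW// partition_step.
Qed.

Lemma tag_mem a b d s xi j : tagged_partition a b d s xi -> (j < size s)%N ->
  a <= xi j <= b.
Proof.
move=> [sab H] js; have [_ l u] := H _ js.
have /andP[al _] := partition_point sab (ltnW js).
have /andP[_ bu] := partition_point sab js.
by rewrite (le_trans al l) (le_trans u bu).
Qed.

Lemma tagged_partition_le a b d d' s xi : d <= d' ->
  tagged_partition a b d s xi -> tagged_partition a b d' s xi.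
Proof.
move=> dd' [sab H]; split => // j js; have [? ? ?] := H _ js.
by split => //; exact: lt_le_trans dd'.
Qed.

Section Linearity.
Variables (V : normedModType R[i]) (a b : R) (g : R -> R[i]).
Implicit Types (f h : R -> V) (v w : V).

Lemma is_RS_integralP f v : is_RS_integral a b g f v <->
  forall eps : R, 0 < eps -> exists2 delta : R, 0 < delta &
    forall s xi, tagged_partition a b delta s xi ->
      rnorm (RS_sum a b g f s xi - v) <= eps.
Proof.
by split=> I e e0; have [d d0 H] := I e e0; exists d => // s xi /H;
  rewrite rnormE lecR.
Qed.

Lemma eq_RS_sum f h d s xi : (forall t, a <= t <= b -> f t = h t) ->
  tagged_partition a b d s xi -> RS_sum a b g f s xi = RS_sum a b g h s xi.
Proof.
move=> fh tp; rewrite /RS_sum !big_nat.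
by apply: eq_bigr => j /andP[_ js]; rewrite fh// (tag_mem tp js).
Qed.

Lemma eq_is_RS_integral f h v : (forall t, a <= t <= b -> f t = h t) ->
  is_RS_integral a b g f v -> is_RS_integral a b g h v.
Proof.
move=> fh I e e0; have [d d0 H] := I e e0; exists d => // s xi tp.
by rewrite -(eq_RS_sum fh tp) H.
Qed.

Lemma is_RS_integral0 : is_RS_integral a b g (fun=> 0 : V) 0.
Proof.
move=> e e0; exists 1 => // s xi _; rewrite /RS_sum big1 => [|j _].
  by rewrite subrr normr0 lecR ltW.
by rewrite scaler0.
Qed.

Lemma is_RS_integralD f h v w : is_RS_integral a b g f v ->
  is_RS_integral a b g h w ->
  is_RS_integral a b g (fun t => f t + h t) (v + w).
Proof.
move=> /is_RS_integralP If /is_RS_integralP Ih; apply/is_RS_integralP => e e0.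
have e20 : 0 < e / 2 by lra.
have [d d0 Hf] := If _ e20; have [d' d'0 Hh] := Ih _ e20.
exists (Num.min d d') => [|s xi tp]; first by rewrite lt_min d0.
have -> : RS_sum a b g (fun t => f t + h t) s xi =
          RS_sum a b g f s xi + RS_sum a b g h s xi.
  by rewrite /RS_sum -big_split; apply: eq_bigr => j _; rewrite scalerDr.
rewrite opprD addrACA (le_trans (rnormD _ _))// [leRHS](splitr e).
apply: lerD; [apply: Hf|apply: Hh]; apply: tagged_partition_le tp.
  by rewrite ge_min lexx.
by rewrite ge_min lexx orbT.
Qed.

Lemma is_RS_integral_unique f v w : a <= b ->
  is_RS_integral a b g f v -> is_RS_integral a b g f w -> v = w.
Proof.
move=> ab /is_RS_integralP Iv /is_RS_integralP Iw.
apply/eqP; rewrite -subr_eq0; apply/eqP/rnorm_eq0/eqP.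
rewrite eq_le rnorm_ge0 andbT; apply/ler_addgt0Pl => e e0; rewrite addr0.
have e20 : 0 < e / 2 by lra.
have [d d0 Hv] := Iv _ e20; have [d' d'0 Hw] := Iw _ e20.
have [||s [xi tp]] := @exists_tagged_partition a b (Num.min d d') => //.
  by rewrite lt_min d0.
rewrite -(subrKA (RS_sum a b g f s xi)) (le_trans (rnormD _ _))//.
rewrite [leRHS](splitr e); apply: lerD.
  rewrite rdistC; apply: Hv; apply: tagged_partition_le tp.
  by rewrite ge_min lexx.
apply: Hw; apply: tagged_partition_le tp.
by rewrite ge_min lexx orbT.
Qed.

End Linearity.

Lemma is_RS_integral_linear (V W : normedModType R[i]) (L : V -> W) (K : R)
    a b g (f : R -> V) v : linear L -> (forall x, rnorm (L x) <= K * rnorm x) ->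
  is_RS_integral a b g f v -> is_RS_integral a b g (L \o f) (L v).
Proof.
move=> linL LK /is_RS_integralP I; apply/is_RS_integralP => e e0.
have K0 : 0 < `|K| + 1 by rewrite ltr_wpDl.
have [d d0 H] := I (e / (`|K| + 1)) (divr_gt0 e0 K0).
exists d => // s xi /H Hs.
have -> : RS_sum a b g (L \o f) s xi = L (RS_sum a b g f s xi).
  by rewrite /RS_sum lin_sum//; apply: eq_bigr => j _; rewrite linZ.
rewrite -linB// (le_trans (LK _))//.
rewrite ler_pdivlMr// mulrC in Hs; apply: le_trans Hs.
by rewrite ler_wpM2r ?rnorm_ge0// (le_trans (ler_norm K))// lerDl.
Qed.

Lemma is_RS_integralZ (V : normedModType R[i]) a b g (f : R -> V) v c :
  is_RS_integral a b g f v ->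
  is_RS_integral a b g (fun t => c *: f t) (c *: v).
Proof.
apply: (@is_RS_integral_linear V V (fun x => c *: x) (rnorm c)).
  by move=> k x y; rewrite scalerDr !scalerA mulrC.
by move=> x; rewrite rnormZ.
Qed.

Lemma is_RS_integral_scale (V : normedModType R[i]) a b g (f : R -> R[i]) v
    (x : V) : is_RS_integral a b g f v ->
  is_RS_integral a b g (fun t => f t *: x) (v *: x).
Proof.
apply: (@is_RS_integral_linear R[i] V (fun k => k *: x) (rnorm x)).
  by move=> k y z; rewrite scalerDl -scalerA.
by move=> k; rewrite rnormZ mulrC.
Qed.

Definition variation_le a b g (M : R) := forall s, itv_partition a b s ->
  \sum_(0 <= j < size s)
    rnorm (g (nth b (a :: s) j.+1) - g (nth b (a :: s) j)) <= M.

(** The sums of [f] differ from the telescoping sum of the increments of [Phi]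
    by [eps] times the variation of [g] plus [b - a].  An error proportional to
    the increment of [g] suits primitives along a contour, and one proportional
    to [t - s] suits functions of the parameter. *)
Lemma is_RS_integral_primitive (V : normedModType R[i]) a b g (M : R)
    (f Phi : R -> V) : a <= b -> variation_le a b g M ->
  (forall eps : R, 0 < eps -> exists2 delta : R, 0 < delta &
     forall s t x, a <= s -> s <= x -> x <= t -> t <= b -> t - s < delta ->
       rnorm (Phi t - Phi s - (g t - g s) *: f x) <=
       eps * (rnorm (g t - g s) + (t - s))) ->
  is_RS_integral a b g f (Phi b - Phi a).
Proof.
move=> ab gM H; apply/is_RS_integralP => e e0.
have M0 : 0 < `|M| + (b - a) + 1 by rewrite ltr_wpDl// addr_ge0// subr_ge0.
have [d d0 Hd] := H _ (divr_gt0 e0 M0).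
exists d => // s xi [sab tp].
rewrite -(partition_telescope Phi sab) -rnormN opprB /RS_sum -sumrB.
rewrite (le_trans (rnorm_sum _ _ _))//.
apply: (@le_trans _ _ (\sum_(0 <= j < size s) e / (`|M| + (b - a) + 1) *
  (rnorm (g (nth b (a :: s) j.+1) - g (nth b (a :: s) j)) +
   (nth b (a :: s) j.+1 - nth b (a :: s) j)))).
  rewrite !big_nat; apply: ler_sum => j /andP[_ js]; have [? ? ?] := tp _ js.
  apply: Hd => //.
    by have /andP[] := partition_point sab (ltnW js).
  by have /andP[] := partition_point sab js.
rewrite -mulr_sumr big_split /= (partition_telescope id sab).
rewrite mulrAC ler_pdivrMr// ler_wpM2l ?(ltW e0)//.
have := gM _ sab; have := ler_norm M; lra.
Qed.

Lemma RS_sum_variation_le (V : normedModType R[i]) a b g (M : R) (f : R -> V)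
    (c : R) d s xi : 0 <= c -> variation_le a b g M ->
  (forall t, a <= t <= b -> rnorm (f t) <= c) ->
  tagged_partition a b d s xi -> rnorm (RS_sum a b g f s xi) <= c * M.
Proof.
move=> c0 gM fc tp; rewrite (le_trans (rnorm_sum _ _ _))//.
apply: le_trans (ler_wpM2l c0 (gM s tp.1)).
rewrite mulr_sumr !big_nat; apply: ler_sum => j /andP[_ js].
by rewrite rnormZ mulrC ler_wpM2r ?rnorm_ge0// fc// (tag_mem tp js).
Qed.

(** The sums of [f - h] are bounded by its supremum times the variation of [g],
    whatever the partition. *)
Lemma is_RS_integral_uniform (V : normedModType R[i]) a b g (M : R)
    (f : R -> V) v : variation_le a b g M ->
  (forall eps : R, 0 < eps -> exists2 h, is_RS_integral a b g h v &
     forall t, a <= t <= b -> rnorm (f t - h t) <= eps) ->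
  is_RS_integral a b g f v.
Proof.
move=> gM H; apply/is_RS_integralP => e e0.
have M0 : 0 < `|M| + 1 by rewrite ltr_wpDl.
have e20 : 0 < e / 2 by lra.
have [h /is_RS_integralP Ih fh] := H _ (divr_gt0 e20 M0).
have [d d0 Hd] := Ih _ e20; exists d => // s xi tp.
have -> : RS_sum a b g f s xi - v =
    RS_sum a b g (fun t => f t - h t) s xi + (RS_sum a b g h s xi - v).
  rewrite addrA; congr (_ - _); rewrite /RS_sum -big_split.
  by apply: eq_bigr => j _; rewrite /= -scalerDr subrK.
rewrite (le_trans (rnormD _ _))// [leRHS](splitr e) lerD ?Hd//.
have c0 : 0 <= e / 2 / (`|M| + 1) by rewrite divr_ge0 ?ltW.
apply: le_trans (RS_sum_variation_le c0 gM fh tp) _.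
rewrite mulrAC ler_pdivrMr// ler_wpM2l ?(ltW e20)//.
by rewrite (le_trans (ler_norm M))// lerDl.
Qed.

End RiemannStieltjes.

(** * Uniform continuity *)

Section UniformContinuity.
Variables (R : realType) (V : normedModType R[i]).

Lemma nbhs_rnormP (x : V) (A : set V) : nbhs x A <->
  exists2 e : R, 0 < e & forall y, rnorm (y - x) < e -> A y.
Proof.
split=> [/nbhs_ballP[e /= e0 xA]|[e e0 xA]].
  have eR : e = (complex.Re e)%:C by rewrite RRe_real// gtr0_real.
  exists (complex.Re e) => [|y yx]; first by rewrite -ltcR -eR.
  by apply: xA; rewrite -ball_normE /= eR rnormE ltcR rdistC.
apply/nbhs_ballP; exists e%:C => /=; first by rewrite ltcR.
by move=> y; rewrite -ball_normE /= rnormE ltcR rdistC; exact: xA.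
Qed.

Lemma within_continuous_rnormP (A : set R) (f : R -> V) :
  {within A, continuous f} <->
  forall x, A x -> forall e : R, 0 < e -> exists2 d : R, 0 < d &
    forall t, A t -> `|t - x| < d -> rnorm (f t - f x) < e.
Proof.
split=> [/subspace_continuousP fc x Ax e e0|H].
  have /cvg_rnormP/(_ e e0) := fc x Ax.
  rewrite /prop_near1 /within /= => /nbhs_ballP[d /= d0 xd].
  by exists d => // t At tx; apply: xd => //; rewrite /ball/= distrC.
apply/subspace_continuousP => x Ax; apply/cvg_rnormP => e e0.
have [d d0 xd] := H x Ax e e0.
rewrite /prop_near1 /within /=; apply/nbhs_ballP; exists d => //= t tx At.
by apply: xd => //; move: tx; rewrite /ball/= distrC.
Qed.

Lemma segment_unif_continuous (a b : R) (f : R -> V) :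
  {within `[a, b], continuous f} ->
  forall e : R, 0 < e -> exists2 d : R, 0 < d &
    forall s t, a <= s <= b -> a <= t <= b -> `|t - s| < d ->
      rnorm (f t - f s) < e.
Proof.
move=> /within_continuous_rnormP fc e e0.
have := @segment_compact _ a b.
move/compact_near_coveringP => /(_ _ (0^'+) (fun d s => a <= s <= b ->
  forall t, a <= t <= b -> `|t - s| < d -> rnorm (f t - f s) < e)) [].
  move=> x; rewrite /= in_itv /= => xab.
  have e20 : 0 < e / 2 by lra.
  have [d d0 xd] := fc x xab _ e20.
  have d20 : 0 < d / 2 by lra.
  near=> y r => yab t tab ty.
  have yx : `|y - x| < d / 2.
    have : ball x (d / 2) y by near: y; exact: nbhsx_ballx.
    by rewrite /ball /= distrC.
  have rd : r < d / 2 by near: r; exact: nbhs_right_lt.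
  rewrite -(subrKA (f x)) (le_lt_trans (rnormD _ _))// [ltRHS](splitr e).
  apply: ltrD.
    apply: xd; first by rewrite /= in_itv.
    rewrite -(subrKA y) (le_lt_trans (ler_normD _ _))// [ltRHS](splitr d).
    by rewrite ltrD// (lt_trans ty).
  rewrite rdistC; apply: xd; first by rewrite /= in_itv.
  by rewrite (lt_trans yx)// [ltRHS](splitr d) ltrDl.
move=> d /= d0 H; exists (d / 2) => [|s t sab tab ts]; first by rewrite divr_gt0.
have := H (d / 2); apply => //=.
- by rewrite sub0r normrN gtr0_norm ?divr_gt0// [ltRHS](splitr d) ltrDl divr_gt0.
- by rewrite divr_gt0.
Unshelve. all: by end_near. Qed.

Lemma lipschitz_within_continuous (A : set R) (f : R -> V) (l : V -> R) (K : R) :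
  (forall x x', `|l x - l x'| <= K * rnorm (x - x')) ->
  {within A, continuous f} -> {within A, continuous (l \o f)}.
Proof.
move=> lK /within_continuous_rnormP fc; apply/subspace_continuousP => x Ax.
apply/cvgrPdist_lt => d d0.
have K1 : 0 < `|K| + 1 by rewrite ltr_wpDl.
have [r r0 xr] := fc x Ax _ (divr_gt0 d0 K1).
rewrite /prop_near1 /within /=; apply/nbhs_ballP; exists r => //= t tx At.
have ftx : rnorm (f t - f x) < d / (`|K| + 1) by apply: xr => //; rewrite distrC.
rewrite (le_lt_trans (lK _ _))// rdistC; rewrite ltr_pdivlMr// mulrC in ftx.
apply: le_lt_trans ftx; rewrite ler_wpM2r ?rnorm_ge0//.
by rewrite (le_trans (ler_norm K))// lerDl.
Qed.

Lemma rnorm_lipschitz (x y : V) : `|rnorm x - rnorm y| <= rnorm (x - y).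
Proof.
rewrite ler_norml; have := rnormD (x - y) y; have := rnormD (y - x) x.
by rewrite !subrK (rdistC y); lra.
Qed.

Lemma rnorm_within_continuous (A : set R) (f : R -> V) (z : V) :
  {within A, continuous f} -> {within A, continuous (fun t => rnorm (f t - z))}.
Proof.
apply: (@lipschitz_within_continuous _ _ (fun x => rnorm (x - z)) 1) => x y.
by rewrite mul1r (le_trans (rnorm_lipschitz _ _))// opprB addrA subrK.
Qed.

Lemma rnorm_continuous : continuous (@rnorm R V).
Proof.
move=> u; apply/cvgrPdist_lt => e e0.
apply/nbhs_rnormP; exists e => // v vu.
by rewrite (le_lt_trans (rnorm_lipschitz _ _))// rdistC.
Qed.

End UniformContinuity.

(** * Integrals of powers along closed contours *)

Section PowerEstimates.
Variable R : realType.
Implicit Types u v w : R[i].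

Lemma rnorm_mulB_le (B C D d : R) u w (x y : R[i]) :
  rnorm u <= B -> rnorm (u - w) <= d -> rnorm y <= D ->
  rnorm (x - y) <= C * d -> rnorm (u * x - w * y) <= (B * C + D) * d.
Proof.
move=> uB uw yD xy.
have -> : u * x - w * y = u * (x - y) + (u - w) * y by ring.
rewrite (le_trans (rnormD _ _))// !rnormM mulrDl -mulrA [D * d]mulrC.
by apply: lerD; apply: ler_pM => //; exact: rnorm_ge0.
Qed.

Lemma rnorm_monomial_le (B : R) p q : exists2 C : R, 0 <= C &
  forall u v w d, rnorm u <= B -> rnorm v <= B -> rnorm w <= B ->
    rnorm (u - w) <= d -> rnorm (v - w) <= d ->
    rnorm (u ^+ p * v ^+ q - w ^+ (p + q)) <= C * d.
Proof.
have wB n w : rnorm w <= B -> rnorm (w ^+ n) <= `|B| ^+ n.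
  move=> h; rewrite rnormX lerXn2r ?nnegrE ?rnorm_ge0//.
  by rewrite (le_trans h) ?ler_norm.
elim: p => [|p [C C0 IH]]; last first.
  exists (`|B| * C + `|B| ^+ (p + q)); first by rewrite addr_ge0 ?mulr_ge0 ?exprn_ge0.
  move=> u v w d uB vB wB' uw vw; rewrite addSn !exprS -mulrA.
  apply: rnorm_mulB_le => //; last exact: IH.
  - by rewrite (le_trans uB) ?ler_norm.
  - exact: wB.
elim: q => [|q [C C0 IH]].
  by exists 0 => // u v w d _ _ _ _ _; rewrite !expr0 mul1r subrr rnorm0 mul0r.
exists (`|B| * C + `|B| ^+ q); first by rewrite addr_ge0 ?mulr_ge0 ?exprn_ge0.
move=> u v w d uB vB wB' uw vw; rewrite add0n mul1r !exprS.
apply: rnorm_mulB_le => //.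
- by rewrite (le_trans vB) ?ler_norm.
- exact: wB.
- by have := IH u v w d uB vB wB' uw vw; rewrite expr0 mul1r.
Qed.

End PowerEstimates.

Section ClosedContour.
Variables (R : realType) (gamma : R -> R[i]) (M : R).
Hypothesis gamma_cont : {within `[0, 1], continuous gamma}.
Hypothesis gamma_closed : gamma 0 = gamma 1.
Hypothesis gamma_var : variation_le 0 1 gamma M.
Implicit Types z w : R[i].

Local Notation trace := (contour_trace gamma).
Local Notation vanishing f := (is_RS_integral 0 1 gamma f 0).

Lemma trace_dist z : ~ trace z ->
  exists2 m : R, 0 < m & forall t, 0 <= t <= 1 -> m <= rnorm (gamma t - z).
Proof.
move=> zt; have [c] := EVT_min ler01 (@rnorm_within_continuous _ _ _ _ z gamma_cont).
rewrite in_itv /= => c01 cmin; exists (rnorm (gamma c - z)) => [|t t01].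
  rewrite lt_neqAle rnorm_ge0 andbT eq_sym; apply/eqP => /rnorm_eq0/eqP.
  rewrite subr_eq0 => /eqP cz; apply: zt; exists c => //.
by apply: cmin; rewrite in_itv.
Qed.

Lemma trace_bounded : exists B : R, forall t, 0 <= t <= 1 -> rnorm (gamma t) <= B.
Proof.
have [c _ cmax] := EVT_max ler01 (@rnorm_within_continuous _ _ _ _ 0 gamma_cont).
exists (rnorm (gamma c - 0)) => t t01; rewrite -[gamma t]subr0.
by apply: cmax; rewrite in_itv.
Qed.

(** The integrand has the primitive [- (k + 1)^-1 (zeta - z)^-(k + 1)], whose
    increment along a closed contour is zero. *)
Lemma inv_power_vanishing z k : ~ trace z ->
  vanishing (fun t => (gamma t - z)^-1 ^+ k.+2).
Proof.
move=> zt; have [m m0 zm] := trace_dist zt.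
pose phi t := (gamma t - z)^-1.
have phiN0 t : 0 <= t <= 1 -> gamma t - z != 0.
  move=> t01; apply/eqP => h; have := zm _ t01.
  by rewrite h rnorm0 leNgt m0.
have phim t : 0 <= t <= 1 -> rnorm (phi t) <= m^-1.
  by move=> t01; rewrite rnormV lef_pV2 ?posrE ?zm// (lt_le_trans m0) ?zm.
pose Phi t := - (k.+1%:R)^-1 * phi t ^+ k.+1.
have -> : 0 = Phi 1 - Phi 0 by rewrite /Phi /phi gamma_closed subrr.
have [C C0 HC] : exists2 C : R, 0 <= C & forall u v w d,
    rnorm u <= m^-1 -> rnorm v <= m^-1 -> rnorm w <= m^-1 ->
    rnorm (u - w) <= d -> rnorm (v - w) <= d ->
    rnorm ((k.+1%:R)^-1 * (\sum_(i < k.+1) u ^+ (k - i).+1 * v ^+ i.+1) -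
           w ^+ k.+2) <= C * d.
  (* both [u^(k - i + 1) v^(i + 1)] and [w^(k + 2)] have degree [k + 2] *)
  have HC (i : 'I_k.+1) : exists C : R, 0 <= C /\ forall u v w d,
      rnorm u <= m^-1 -> rnorm v <= m^-1 -> rnorm w <= m^-1 ->
      rnorm (u - w) <= d -> rnorm (v - w) <= d ->
      rnorm (u ^+ (k - i).+1 * v ^+ i.+1 - w ^+ k.+2) <= C * d.
    have [C C0 H] := rnorm_monomial_le m^-1 (k - i).+1 i.+1.
    exists C; split => // u v w d uB vB wB uw vw.
    have -> : k.+2 = ((k - i).+1 + i.+1)%N.
      by rewrite addSn addnS subnK// -ltnS ltn_ord.
    exact: H.
  have [c Hc] := choice HC.
  exists (\sum_i c i); first by apply: sumr_ge0 => i _; have [] := Hc i.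
  move=> u v w d uB vB wB uw vw.
  have d0 : 0 <= d by rewrite (le_trans (rnorm_ge0 (u - w))).
  have k0 : (k.+1%:R : R[i]) != 0 by rewrite pnatr_eq0.
  have -> : (k.+1%:R)^-1 * (\sum_(i < k.+1) u ^+ (k - i).+1 * v ^+ i.+1) - w ^+ k.+2
     = (k.+1%:R)^-1 * (\sum_(i < k.+1) (u ^+ (k - i).+1 * v ^+ i.+1 - w ^+ k.+2)).
    by rewrite sumrB sumr_const card_ord mulrBr -[w ^+ k.+2 *+ _]mulr_natl mulKf.
  rewrite rnormM (@le_trans _ _ (1 * (\sum_(i < k.+1) c i * d)))//; last first.
    by rewrite mul1r mulr_suml.
  apply: ler_pM; rewrite ?rnorm_ge0//.
    rewrite rnormV -(rmorph_nat (real_complex R)) rnormC normr_nat.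
    by rewrite invf_le1 ?ler1n ?ltr0n.
  rewrite (le_trans (rnorm_sum _ _ _))//; apply: ler_sum => i _.
  by have [_] := Hc i; exact.
apply: (is_RS_integral_primitive ler01 gamma_var) => e e0.
have C10 : 0 < C + 1 by rewrite ltr_wpDl.
have [d d0 Hd] := segment_unif_continuous gamma_cont
  (mulr_gt0 (divr_gt0 e0 C10) (exprn_gt0 2 m0)).
exists d => // s t x s0 sx xt t1 ts.
have s01 : 0 <= s <= 1 by lra.
have t01 : 0 <= t <= 1 by lra.
have x01 : 0 <= x <= 1 by lra.
have phiB p q : 0 <= p <= 1 -> 0 <= q <= 1 ->
    phi p - phi q = - (gamma p - gamma q) * (phi p * phi q).
  move=> p01 q01; rewrite /phi; have := phiN0 _ p01; have := phiN0 _ q01.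
  by move=> ? ?; field; apply/andP.
have phid p : 0 <= p <= 1 -> `|p - x| < d -> rnorm (phi p - phi x) <= e / (C + 1).
  move=> p01 px; rewrite phiB// !rnormM rnormN.
  have -> : e / (C + 1) = e / (C + 1) * m ^+ 2 * (m^-1 * m^-1).
    by field; rewrite !gt_eqF.
  apply: ler_pM; rewrite ?mulr_ge0 ?rnorm_ge0//; first by rewrite ltW ?Hd.
  by apply: ler_pM; rewrite ?rnorm_ge0 ?phim.
have -> : Phi t - Phi s - (gamma t - gamma s) *: phi x ^+ k.+2 =
    (gamma t - gamma s) * ((k.+1%:R)^-1 *
      (\sum_(i < k.+1) phi t ^+ (k - i).+1 * phi s ^+ i.+1) - phi x ^+ k.+2).
  rewrite mulrBr; congr (_ - _).
  rewrite /Phi -mulrBr subrXX phiB//=.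
  have -> : \sum_(i < k.+1) phi t ^+ (k - i).+1 * phi s ^+ i.+1 =
      phi t * phi s * \sum_(i < k.+1) phi t ^+ (k - i) * phi s ^+ i.
    by rewrite mulr_sumr; apply: eq_bigr => i _; rewrite !exprS; ring.
  by ring.
rewrite rnormM mulrC -[e]mulr1.
apply: (@le_trans _ _ (e * rnorm (gamma t - gamma s))); last first.
  by rewrite mulr1 ler_wpM2l ?(ltW e0)// lerDl subr_ge0 (le_trans sx).
rewrite ler_wpM2r ?rnorm_ge0//.
apply: le_trans (HC _ _ (phi x) (e / (C + 1)) _ _ _ _ _) _; rewrite ?phim ?phid//.
- by rewrite ger0_norm; lra.
- by rewrite ler0_norm; lra.
- by rewrite mulrCA ger_pMr// ler_pdivrMr// mul1r lerDl.
Qed.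

Lemma vanishing_sum (I : Type) (r : seq I) (c : I -> R[i]) (f : I -> R -> R[i]) :
  (forall i, vanishing (f i)) -> vanishing (fun t => \sum_(i <- r) c i * f i t).
Proof.
move=> fv; elim: r => [|i r IH].
  apply: eq_is_RS_integral (is_RS_integral0 _ _ _ _) => t _.
  by rewrite big_nil.
have := is_RS_integralD (is_RS_integralZ (c i) (fv i)) IH.
rewrite scaler0 addr0; apply: eq_is_RS_integral => t _.
by rewrite big_cons.
Qed.

End ClosedContour.

(** * Winding numbers *)

Section Winding.
Variables (R : realType) (gamma : R -> R[i]) (M : R).
Hypothesis gamma_cont : {within `[0, 1], continuous gamma}.
Hypothesis gamma_closed : gamma 0 = gamma 1.
Hypothesis gamma_var : variation_le 0 1 gamma M.
Implicit Types z w : R[i].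

Local Notation trace := (contour_trace gamma).
Local Notation vanishing f := (is_RS_integral 0 1 gamma f 0).

Lemma exists_expr_le (q e : R) : 0 <= q < 1 -> 0 < e -> exists n, q ^+ n <= e.
Proof.
move=> /andP[q0 q1] e0; have := @cvg_expr _ q; rewrite ger0_norm// => /(_ q1).
move=> /cvgrPdist_lt/(_ e e0)[N _ /(_ N (leqnn _))] /=.
rewrite sub0r normrN ger0_norm ?exprn_ge0// => /ltW qe.
by exists N.
Qed.

(** An integral of the difference, rather than an equality of two integrals:
    the difference is integrable as a uniform limit of functions with
    primitives, which says nothing about the two terms. *)
Definition same_winding z w :=
  vanishing (fun t => (gamma t - w)^-1 - (gamma t - z)^-1).

(** [(zeta - w)^-1 - (zeta - z)^-1] is a geometric series in
    [(w - z) / (zeta - z)], uniformly convergent on the contour, whose terms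
    are powers of [(zeta - z)^-1] with exponent at least [2]. *)
Lemma same_winding_close z w (q : R) : ~ trace z -> ~ trace w ->
  0 <= q < 1 ->
  (forall t, 0 <= t <= 1 -> rnorm (w - z) <= q * rnorm (gamma t - z)) ->
  same_winding z w.
Proof.
move=> zt wt q01 close.
have [m m0 mz] := trace_dist gamma_cont zt.
have [m' m'0 mw] := trace_dist gamma_cont wt.
apply: (is_RS_integral_uniform gamma_var) => e e0.
have [n qn] := exists_expr_le q01 (mulr_gt0 e0 m'0).
have /andP[q0 /ltW q1] := q01.
exists (fun t => \sum_(0 <= k < n) (w - z) ^+ k.+1 * (gamma t - z)^-1 ^+ k.+2).
  apply: vanishing_sum => k.
  exact: (inv_power_vanishing gamma_cont gamma_closed gamma_var).
move=> t t01.
have gzN0 : gamma t - z != 0.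
  by apply/eqP => h; have := mz _ t01; rewrite h rnorm0 leNgt m0.
have gwN0 : gamma t - w != 0.
  by apply/eqP => h; have := mw _ t01; rewrite h rnorm0 leNgt m'0.
have -> : (gamma t - w)^-1 - (gamma t - z)^-1 -
    \sum_(0 <= k < n) (w - z) ^+ k.+1 * (gamma t - z)^-1 ^+ k.+2 =
    ((w - z) / (gamma t - z)) ^+ n.+1 * (gamma t - w)^-1.
  elim: (n) => [|j IH].
    by rewrite big_geq// subr0 expr1; field; apply/andP.
  rewrite big_nat_recr//= opprD addrA IH !exprMn !exprS.
  by field; rewrite ?expf_neq0 ?gzN0 ?gwN0.
rewrite rnormM rnormX rnormV rnormM rnormV exprS.
have gz0 : 0 < rnorm (gamma t - z) by exact: lt_le_trans (mz _ t01).
have gw0 : 0 < rnorm (gamma t - w) by exact: lt_le_trans (mw _ t01).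
have xq : rnorm (w - z) / rnorm (gamma t - z) <= q.
  by rewrite ler_pdivrMr// close.
have x0 : 0 <= rnorm (w - z) / rnorm (gamma t - z).
  by rewrite divr_ge0 ?rnorm_ge0.
rewrite ler_pdivrMr//; apply: (@le_trans _ _ (e * m')); last first.
  by rewrite ler_wpM2l ?(ltW e0)// mw.
apply: le_trans qn; rewrite -[leRHS]mul1r; apply: ler_pM => //.
- by rewrite exprn_ge0.
- exact: le_trans xq q1.
- by rewrite lerXn2r ?nnegrE.
Qed.

Lemma same_winding_near z : ~ trace z ->
  exists2 d : R, 0 < d & forall w, rnorm (w - z) < d ->
    ~ trace w /\ same_winding z w.
Proof.
move=> zt; have [m m0 mz] := trace_dist gamma_cont zt.
exists (m / 2) => [|w wz]; first by rewrite divr_gt0.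
have wt : ~ trace w.
  move=> [t]; rewrite /= in_itv/= => t01 tw; have := mz _ t01.
  rewrite tw leNgt => /negP; apply; lra.
split => //; apply: (@same_winding_close z w 2^-1) => //; first by lra.
by move=> t t01; have := mz _ t01; lra.
Qed.

Lemma same_winding_sym z w : same_winding z w -> same_winding w z.
Proof.
move=> zw.
have := is_RS_integralZ (-1) zw.
rewrite scaler0; apply: eq_is_RS_integral => t _.
by rewrite scaleN1r opprB.
Qed.

Lemma same_winding_trans z w w' :
  same_winding z w -> same_winding w w' -> same_winding z w'.
Proof.
move=> zw ww'; have := is_RS_integralD zw ww'; rewrite addr0.
by apply: eq_is_RS_integral => t _; rewrite addrC subrKA.
Qed.

(** The contour integral is locally constant in the pole, so it is constant on
    the components of the complement of the contour. *)
Lemma same_winding_component z w : ~ trace z ->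
  connected_component (~` trace) z w -> ~ trace w /\ same_winding z w.
Proof.
move=> zt; set U := connected_component _ _.
have locally_open (P : R[i] -> Prop) :
    (forall u v, same_winding u v -> P u -> P v) ->
    open [set u | ~ trace u /\ P u].
  move=> PP; rewrite openE => u [ut Pu]; apply/nbhs_rnormP.
  have [d d0 ud] := same_winding_near ut; exists d => // v /ud[vt uv].
  by split => //; exact: PP Pu.
have Ut u : U u -> ~ trace u by move=> /connected_component_sub; exact.
have zz : same_winding z z.
  by apply: eq_is_RS_integral (is_RS_integral0 _ _ _ _) => t _; rewrite subrr.
suff -> : U = [set u | U u /\ same_winding z u].
  by move=> [Uw zw]; split => //; exact: Ut.
apply/esym; apply: (@component_connected _ (~` trace) z).
- exists z; split => //; exact: connected_component_refl.
- exists [set u | ~ trace u /\ same_winding z u].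
    by apply: locally_open => u v uv zu; exact: same_winding_trans uv.
  apply/seteqP; split=> u [Uu]; last by case=> _ zu; split; [exact: Uu|exact: zu].
  by move=> zu; split; [exact: Uu|split; [exact: Ut|exact: zu]].
- exists (~` [set u | ~ trace u /\ ~ same_winding z u]).
    apply: open_closedC; apply: locally_open => u v uv zu zv; apply: zu.
    by apply: same_winding_trans zv _; exact: same_winding_sym.
  apply/seteqP; split=> u [Uu zu]; split; try exact: Uu.
    by case=> _; apply; exact: zu.
  by apply: contrapT => nzu; apply: zu; split; [exact: Ut|exact: nzu].
Qed.

(** The integral tends to zero when the pole goes to infinity, and it does so
    within the component of a point which is not enclosed. *)
Lemma outside_vanishing z : ~ trace z -> ~ inside gamma z ->
  vanishing (fun t => (gamma t - z)^-1).
Proof.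
move=> zt zo.
have [B gB] := trace_bounded gamma_cont.
have far (K : R) : exists2 w, connected_component (~` trace) z w & K < rnorm w.
  apply: contrapT => nfar; apply: zo; split => //.
  apply/bounded_rnormP; exists K => w zw; rewrite leNgt; apply/negP => Kw.
  by apply: nfar; exists w.
apply: (is_RS_integral_uniform gamma_var) => e e0.
have [w /(same_winding_component zt)[wt zw] Bw] := far (B + e^-1).
exists (fun t => (gamma t - z)^-1 - (gamma t - w)^-1).
  exact: same_winding_sym zw.
move=> t t01; rewrite opprB addrC subrK rnormV.
have := gB _ t01; have := rnormD (w - gamma t) (gamma t).
rewrite subrK rdistC => h1 h2.
have h : e^-1 <= rnorm (gamma t - w) by lra.
have ei0 : 0 < e^-1 by rewrite invr_gt0.
by rewrite invf_ple ?posrE// (lt_le_trans ei0).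
Qed.

End Winding.

(** * Circles around the origin *)

Section Cis.
Variable R : realType.
Implicit Types a b h t : R.

Definition cis a : R[i] := cos a +i* sin a.

Lemma cisD a b : cis (a + b) = cis a * cis b.
Proof.
rewrite /cis cosD sinD; apply/eqP; rewrite eq_complex /=.
by rewrite eqxx /= addrC [cos a * sin b]mulrC mulrC eqxx.
Qed.

Lemma cis0 : cis 0 = 1.
Proof. by rewrite /cis cos0 sin0. Qed.

Lemma rnorm_cis a : rnorm (cis a) = 1.
Proof. by rewrite /rnorm normc_def /= cos2Dsin2 sqrtr1. Qed.

Lemma cis_neq0 a : cis a != 0.
Proof.
apply/eqP => h; have := rnorm_cis a; rewrite h rnorm0 => /eqP.
by rewrite eq_sym oner_eq0.
Qed.

Lemma cisN a : cis (- a) = (cis a)^-1.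
Proof.
apply: (mulfI (cis_neq0 a)); rewrite -cisD subrr cis0 divff//.
exact: cis_neq0.
Qed.

Lemma mean_value_from0 (f df : R -> R) h :
  (forall x, is_derive x (1 : R) f (df x)) ->
  exists2 c, `|c| <= `|h| & f h - f 0 = df c * h.
Proof.
move=> fd.
have fc (A : set R) : {within A, continuous f}.
  apply: continuous_subspaceT => x; apply: differentiable_continuous.
  exact/derivable1_diffP.
have [h0|h0] := lerP 0 h.
  have [c] := MVT_segment h0 (fun x _ => fd x) (fc _).
  rewrite in_itv /= subr0 => /andP[c0 ch] E; exists c => //.
  by rewrite !ger0_norm.
have [c] := MVT_segment (ltW h0) (fun x _ => fd x) (fc _).
rewrite in_itv /= sub0r => /andP[hc c0] E; exists c.
  by rewrite ler0_norm// ler0_norm ?(ltW h0)// lerN2.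
by rewrite -opprB E mulrN opprK.
Qed.

Lemma sin_le h : `|sin h| <= `|h|.
Proof.
have [c _] := mean_value_from0 h (@is_derive_sin R).
rewrite sin0 subr0 => ->; rewrite normrM.
by rewrite ler_piMl// cos_max.
Qed.

Lemma cosB1_le h : `|cos h - 1| <= h ^+ 2.
Proof.
have [c ch] := mean_value_from0 h (@is_derive_cos R).
rewrite cos0 => ->; rewrite normrM normrN -real_normK ?num_real// expr2.
by rewrite ler_wpM2r// (le_trans (sin_le c)).
Qed.

Lemma sinB_le h : `|h| <= 1 -> `|sin h - h| <= h ^+ 2.
Proof.
move=> h1; have [c ch] := mean_value_from0 h (@is_derive_sin R).
rewrite sin0 subr0 => ->; rewrite -[X in _ - X]mul1r -mulrBl normrM.
rewrite -real_normK ?num_real// expr2 ler_wpM2r// (le_trans (cosB1_le c))//.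
rewrite -real_normK ?num_real//; apply: (@le_trans _ _ (`|h| ^+ 2)).
  by rewrite lerXn2r.
by rewrite expr2 ler_piMl.
Qed.

Lemma cis_taylor h : `|h| <= 1 -> rnorm (cis h - 1 - h%:C * 'i%C) <= 2 * h ^+ 2.
Proof.
move=> h1; rewrite (le_trans (rnorm_le_ReIm _))//.
have -> : cis h - 1 - h%:C * 'i%C = (cos h - 1) +i* (sin h - h).
  by rewrite /cis; apply/eqP; rewrite eq_complex /=; apply/andP; split; apply/eqP; ring.
by rewrite /= mulr2n mulrDl mul1r lerD ?cosB1_le ?sinB_le.
Qed.

Lemma cis_lipschitz a b : rnorm (cis a - cis b) <= 2 * `|a - b|.
Proof.
have -> : cis a - cis b = cis b * (cis (a - b) - 1).
  by rewrite mulrBr mulr1 -cisD subrKC.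
rewrite rnormM rnorm_cis mul1r (le_trans (rnorm_le_ReIm _))//=.
rewrite mulr2n mulrDl mul1r subr0 lerD ?sin_le//.
have [c _] := mean_value_from0 (a - b) (@is_derive_cos R).
by rewrite cos0 => ->; rewrite normrM normrN ler_piMl// sin_max.
Qed.

(** By the duplication formula [sin (a / 2) = 0], and the sine is positive on
    the open interval from [0] to [pi]. *)
Lemma cis_eq1 a : `|a| < pi *+ 2 -> cis a = 1 -> a = 0.
Proof.
move=> a2 /eqP; rewrite eq_complex /= => /andP[/eqP ca _].
apply/eqP/negPn/negP => aN0.
have : 0 < sin (`|a| / 2).
  apply: sin_gt0_pi; rewrite divr_gt0 ?normr_gt0//=.
  by rewrite ltr_pdivrMr// mulr_natr.
suff -> : sin (`|a| / 2) = 0 by rewrite ltxx.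
apply/eqP; rewrite -sqrf_eq0 sin2cos2.
have := cos_mulr2n (`|a| / 2).
rewrite -[_ / 2 *+ 2]mulr_natr divfK ?pnatr_eq0// cos_norm ca => h.
by apply/eqP; lra.
Qed.

(** The angle is the [acos] of the real part, reflected when the imaginary part
    is negative. *)
Lemma cis_surj (z : R[i]) : rnorm z = 1 -> exists2 a, 0 <= a <= pi *+ 2 & z = cis a.
Proof.
move=> z1; have := rnorm_sqr z; rewrite z1 expr1n.
case: z z1 => x y _ /= xy.
have x1 : -1 <= x <= 1.
  have : x ^+ 2 <= 1 by rewrite xy lerDl sqr_ge0.
  by rewrite -ler_sqrt// sqrtr_sqr sqrtr1 ler_norml.
have [a0 api] := (acos_ge0 x1, acos_lepi x1).
have sa : sin (acos x) = `|y|.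
  by rewrite sin_acos// xy addrC addKr sqrtr_sqr.
have ca : cos (acos x) = x by rewrite acosK// in_itv.
have p0 := pi_ge0 R.
have [y0|y0] := lerP 0 y.
  exists (acos x); first by rewrite a0 mulr2n; lra.
  by rewrite /cis ca sa ger0_norm.
exists (pi *+ 2 - acos x); first by rewrite mulr2n; apply/andP; split; lra.
rewrite /cis cosB sinB cos2pi sin2pi ca sa ltr0_norm//.
by rewrite !mul0r mul1r sub0r addr0 mul1r opprK.
Qed.

End Cis.

Section Circle.
Variables (R : realType) (r : R).
Hypothesis r0 : 0 < r.

Definition circle (t : R) : R[i] := r%:C * cis (pi *+ 2 * t).

Let rN0 : r%:C != 0 :> R[i].
Proof. by rewrite eq_complex /= eqxx andbT gt_eqF. Qed.

Let pi2 : 0 < pi *+ 2 :> R.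
Proof. by rewrite pmulrn_rgt0// pi_gt0. Qed.

Lemma rnorm_circle t : rnorm (circle t) = r.
Proof. by rewrite rnormM rnormC rnorm_cis mulr1 gtr0_norm. Qed.

Lemma circle_lipschitz s t :
  rnorm (circle s - circle t) <= r * (2 * (pi *+ 2)) * `|s - t|.
Proof.
rewrite -mulrBr rnormM rnormC gtr0_norm// -mulrA ler_wpM2l ?(ltW r0)//.
rewrite (le_trans (cis_lipschitz _ _))// -mulrBr normrM gtr0_norm//.
by rewrite mulrA.
Qed.

Let L0 : 0 < r * (2 * (pi *+ 2)).
Proof. by rewrite !mulr_gt0. Qed.

Lemma circle_continuous : {within `[0, 1], continuous circle}.
Proof.
apply/within_continuous_rnormP => x _ e e0.
exists (e / (r * (2 * (pi *+ 2)))) => [|t _ tx]; first exact: divr_gt0.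
by rewrite (le_lt_trans (circle_lipschitz _ _))// mulrC -ltr_pdivlMr.
Qed.

Lemma circle_closed : circle 0 = circle 1.
Proof. by rewrite /circle mulr0 mulr1 /cis cos0 sin0 cos2pi sin2pi. Qed.

Lemma circle_inj : {in `[0, 1[ &, injective circle}.
Proof.
move=> s t; rewrite !in_itv /= => s01 t01 /(mulfI rN0) st.
apply/eqP; rewrite -subr_eq0; apply/eqP.
have : cis (pi *+ 2 * (s - t)) = 1.
  by rewrite mulrBr cisD cisN st divff// cis_neq0.
move/cis_eq1; rewrite normrM gtr0_norm// gtr_pMr// => H.
have /eqP : pi *+ 2 * (s - t) = 0 by apply: H; rewrite ltr_norml; lra.
by rewrite mulf_eq0 gt_eqF//= => /eqP.
Qed.

Lemma circle_variation : variation_le 0 1 circle (r * (2 * (pi *+ 2))).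
Proof.
move=> s s01; rewrite -[leRHS]mulr1 -[X in _ * X]subr0.
rewrite -(partition_telescope id s01) mulr_sumr !big_nat.
apply: ler_sum => j /andP[_ js]; rewrite (le_trans (circle_lipschitz _ _))//.
by rewrite ger0_norm// subr_ge0 ltW// partition_step.
Qed.

Lemma circle_trace z : contour_trace circle z <-> rnorm z = r.
Proof.
split=> [[t _ <-]|zr]; first exact: rnorm_circle.
have [|a a2 za] := @cis_surj R (z / r%:C).
  by rewrite rnormM rnormV rnormC gtr0_norm// zr divff ?gt_eqF.
exists (a / (pi *+ 2)).
  rewrite /= in_itv /= divr_ge0 ?(ltW pi2)//; last by case/andP: a2.
  by rewrite ler_pdivrMr// mul1r; case/andP: a2.
by rewrite /circle [_ * (a / _)]mulrC divfK ?gt_eqF// -za mulrC divfK.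
Qed.

(** The angle [2 pi i t] is a logarithm of [circle t], up to a constant, and
    its increments are those of the integrand to first order. *)
Lemma circle_winding0 :
  is_RS_integral 0 1 circle (fun t => (circle t - 0)^-1) (2 * pi%:C * 'i).
Proof.
pose Phi (t : R) : R[i] := (pi *+ 2 * t)%:C * 'i%C.
have -> : 2 * pi%:C * 'i = Phi 1 - Phi 0.
  rewrite /Phi -complexiE mulr0 mulr1 mul0r subr0 mulr2n rmorphD /=.
  by ring.
apply: (is_RS_integral_primitive ler01 circle_variation) => e e0.
have := pi2; rewrite /Phi; set p := pi *+ 2 => p0.
exists (Num.min p^-1 (e / (4 * p ^+ 2))).
  by rewrite lt_min invr_gt0 p0 divr_gt0// mulr_gt0// exprn_gt0.
move=> s t x s0 sx xt t1; rewrite lt_min => /andP[ts1 ts2].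
have -> : (p * t)%:C * 'i%C - (p * s)%:C * 'i%C -
    (circle t - circle s) *: (circle x - 0)^-1 =
   (cis (p * (s - x)) - 1 - (p * (s - x))%:C * 'i%C) -
   (cis (p * (t - x)) - 1 - (p * (t - x))%:C * 'i%C).
  have -> : (circle t - circle s) *: (circle x - 0)^-1 =
    cis (p * (t - x)) - cis (p * (s - x)).
    rewrite subr0 !mulrBr !cisD !cisN -mulrBl /circle -/p -mulrBr.
    rewrite -[LHS]/(_ * _); field.
    by rewrite rN0 cis_neq0.
  by rewrite !mulrBr !rmorphB /=; ring.
have tsp : p * (t - s) < 1 by rewrite -ltr_pdivlMl// mulr1.
have sx0 : 0 <= p * (x - s) <= p * (t - s).
  by rewrite mulr_ge0 ?subr_ge0 ?(ltW p0)//= ler_wpM2l ?(ltW p0)//; lra.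
have tx0 : 0 <= p * (t - x) <= p * (t - s).
  by rewrite mulr_ge0 ?subr_ge0 ?(ltW p0)//= ler_wpM2l ?(ltW p0)//; lra.
have h1 : `|p * (s - x)| <= 1.
  by rewrite -normrN -mulrN opprB ger0_norm; lra.
have h2 : `|p * (t - x)| <= 1 by rewrite ger0_norm; lra.
rewrite (le_trans (rnormB _ _))//.
apply: (le_trans (lerD (cis_taylor h1) (cis_taylor h2))).
have k1 : (p * (s - x)) ^+ 2 <= (p * (t - s)) ^+ 2.
  by rewrite -sqrrN -mulrN opprB lerXn2r ?nnegrE; lra.
have k2 : (p * (t - x)) ^+ 2 <= (p * (t - s)) ^+ 2.
  by rewrite lerXn2r ?nnegrE; lra.
apply: (@le_trans _ _ (e * (t - s))); last first.
  by rewrite ler_wpM2l ?(ltW e0)// lerDr rnorm_ge0.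
apply: (@le_trans _ _ ((4 * p ^+ 2 * (t - s)) * (t - s))).
  by rewrite exprMn in k1 k2 *; lra.
rewrite ler_wpM2r ?subr_ge0 ?(le_trans sx)// mulrC -ler_pdivlMr ?ltW//.
by rewrite mulr_gt0// exprn_gt0.
Qed.

Lemma circle_jordan : jordan_contour circle.
Proof.
split; [exact: circle_continuous|exact: circle_closed|exact: circle_inj|].
exists (r * (2 * (pi *+ 2))) => s s01.
rewrite (eq_bigr (fun j => (rnorm (circle (nth 1 (0 :: s) j.+1) -
  circle (nth 1 (0 :: s) j)))%:C)) => [|j _]; last by rewrite rnormE.
by rewrite -rmorph_sum /= lecR; exact: circle_variation.
Qed.

(** A point of modulus at least [r] escapes to infinity along a ray. *)
Lemma inside_circle_lt z : inside circle z -> rnorm z < r.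
Proof.
move=> [zt zb]; rewrite ltNge; apply/negP => rz.
have z0 : 0 < rnorm z by exact: lt_le_trans rz.
pose ray : set R[i] := (fun s : R => s%:C * z) @` `[1, +oo[.
have ray_conn : connected ray.
  apply: connected_continuous_connected.
    exact/connected_intervalP/interval_is_interval.
  apply/within_continuous_rnormP => x _ e e0.
  exists (e / rnorm z) => [|t _ tx]; first exact: divr_gt0.
  by rewrite -mulrBl -rmorphB rnormM rnormC -ltr_pdivlMr.
have ray_sub : ray `<=` ~` contour_trace circle.
  move=> _ [s /= + <-]; rewrite in_itv /= andbT => s1.
  have [<-|s1'] := eqVneq 1 s; first by rewrite mul1r.
  move/circle_trace; rewrite rnormM rnormC ger0_norm; last by rewrite (le_trans ler01).
  move=> sz; have : rnorm z < s * rnorm z by rewrite ltr_pMl// lt_neqAle s1'.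
  by rewrite sz ltNge rz.
have rayz : ray z by exists 1; [rewrite /= in_itv /= lexx|rewrite mul1r].
have [B HB] := (bounded_rnormP _).1 zb.
have K0 : 0 <= `|B| / rnorm z by rewrite divr_ge0 ?rnorm_ge0.
have far : rnorm ((`|B| / rnorm z + 1)%:C * z) = `|B| + rnorm z.
  rewrite rnormM rnormC (ger0_norm (addr_ge0 K0 ler01)) mulrDl mul1r divfK//.
  by rewrite gt_eqF.
have /HB : connected_component (~` contour_trace circle) z
    ((`|B| / rnorm z + 1)%:C * z).
  apply: (connected_component_max rayz ray_sub ray_conn).
  by exists (`|B| / rnorm z + 1) => //=; rewrite in_itv /= andbT lerDr.
by rewrite far; have := ler_norm B; lra.
Qed.

(** The modulus of a connected set avoiding the circle cannot jump over [r]. *)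
Lemma inside_circle0 : inside circle 0.
Proof.
have t0 : ~ contour_trace circle 0.
  by move/circle_trace/eqP; rewrite rnorm0 eq_sym gt_eqF.
split => //; apply/bounded_rnormP; exists r => z Uz.
rewrite leNgt; apply/negP => rz.
set U := connected_component _ _ in Uz.
have Ic : connected ((fun u : R[i] => rnorm u) @` U).
  apply: connected_continuous_connected; first exact: component_connected.
  apply: continuous_subspaceT; exact: rnorm_continuous.
have U0 : ((fun u : R[i] => rnorm u) @` U) 0.
  by exists 0; [exact: connected_component_refl|rewrite rnorm0].
have Uz' : ((fun u : R[i] => rnorm u) @` U) (rnorm z) by exists z.
have [|u Uu ur] := (connected_intervalP _).1 Ic _ _ U0 Uz' r.
  by rewrite !ltW.
by have /circle_trace := connected_component_sub Uu; exact.
Qed.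

(** Around the origin the integral is explicit, and an enclosed point is close
    enough to the origin for [same_winding_close]. *)
Lemma circle_positive : positively_oriented circle.
Proof.
move=> z zi; have zr := inside_circle_lt zi.
have zt : ~ contour_trace circle z by case: zi.
have t0 : ~ contour_trace circle 0 by case: inside_circle0.
have q01 : 0 <= rnorm z / r < 1.
  by rewrite divr_ge0 ?rnorm_ge0 ?(ltW r0)//= ltr_pdivrMr// mul1r.
have close t : 0 <= t <= 1 -> rnorm (z - 0) <= rnorm z / r * rnorm (circle t - 0).
  by move=> _; rewrite !subr0 rnorm_circle divfK ?gt_eqF.
have := same_winding_close circle_continuous circle_closed circle_variation
  t0 zt q01 close.
move=> /(is_RS_integralD)/(_ circle_winding0); rewrite add0r.
by apply: eq_is_RS_integral => t _; rewrite subrK.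
Qed.

End Circle.

(** * Finite-dimensional norms *)

Section Square.
Variable R : realType.

Definition unit_square : set R[i] :=
  [set z | `|complex.Re z| <= 1 /\ `|complex.Im z| <= 1].

Lemma compact_unit_square : compact unit_square.
Proof.
have -> : unit_square = (fun p : R * R => p.1 +i* p.2) @`
    (`[(-1)%R, 1%R] `*` `[(-1)%R, 1%R]).
  apply/seteqP; split=> [[x y] /= [x1 y1]|_ [[x y] /= + <-]].
    by exists (x, y) => //=; rewrite !in_itv /= -!ler_norml.
  by rewrite !in_itv /= -!ler_norml.
apply: continuous_compact; last by apply: compact_setX; exact: segment_compact.
apply: continuous_subspaceT => -[x y]; apply/cvg_rnormP => e e0.
have e20 : 0 < e / 2 by rewrite divr_gt0.
exists (ball x (e / 2), ball y (e / 2)); first by split; exact: nbhsx_ballx.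
move=> [x' y'] /= [xx yy].
rewrite (le_lt_trans (rnorm_le_ReIm _))//= [ltRHS](splitr e) ltrD//.
  by rewrite distrC.
by rewrite distrC.
Qed.

End Square.

Section Coordinates.
Variables (R : realType) (X : normedModType R[i]) (n : nat) (e : 'I_n -> X).
Hypothesis e_basis : is_basis e.
Implicit Types x y : X.

Definition coord x : 'rV[R[i]]_n := projT1 (cid (e_basis x)).

Lemma coordE x : x = \sum_i coord x 0 i *: e i.
Proof. by rewrite /coord; case: cid => c []. Qed.

Lemma coord_unique x (c : 'rV[R[i]]_n) : x = \sum_i c 0 i *: e i -> coord x = c.
Proof. by move=> xc; rewrite /coord; case: cid => d /= [_ ]; exact. Qed.

Lemma coord_linear : linear coord.
Proof.
move=> a x y; apply: coord_unique.
rewrite {1}(coordE x) {1}(coordE y) scaler_sumr -big_split /=.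
by apply: eq_bigr => i _; rewrite !mxE scalerDl scalerA.
Qed.

Lemma coordB x y : coord (x - y) = coord x - coord y.
Proof. exact: linB coord_linear x y. Qed.

Lemma coord_inj : injective coord.
Proof. by move=> x y xy; rewrite (coordE x) xy -coordE. Qed.

(** The norm of [\sum_j c_j e_j] is bounded from below on the compact set of the
    [c] with [c_i = 1] and entries in the unit square, where it does not
    vanish; dividing [coord x] by its largest entry moves it into that set. *)
Lemma coord_bounded : exists2 K : R, 0 < K &
  forall x i, rnorm (coord x 0 i) <= K * rnorm x.
Proof.
have Hk0 (i : 'I_n) : exists k : R, 0 < k /\
    forall c : 'rV[R[i]]_n, c 0 i = 1 -> (forall j, rnorm (c 0 j) <= 1) ->
      k <= rnorm (\sum_j c 0 j *: e j).
  pose S := [set c : 'rV[R[i]]_n | forall j,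
    (if j == i then [set 1] else @unit_square R) (c ord0 j)].
  have S0 : S !=set0.
    exists (const_mx 1) => j; rewrite mxE; case: eqP => //= _.
    by split; rewrite /= ?normr1 ?normr0.
  have Sc : compact S.
    apply: (@rV_compact _ n
      (fun j => if j == i then [set 1] else @unit_square R)) => j.
    case: eqP => _; first exact: compact_set1.
    exact: compact_unit_square.
  have Sf : {within S, continuous
      (fun c : 'rV[R[i]]_n => rnorm (\sum_j c 0 j *: e j))}.
    have sum_cont (s : seq 'I_n) :
        continuous (fun c : 'rV[R[i]]_n => \sum_(i <- s) c 0 i *: e i).
      elim: s => [|j s IH].
        have -> : (fun c : 'rV[R[i]]_n => \sum_(i <- [::]) c 0 i *: e i) = fun=> 0.
          by apply/funext => d; rewrite big_nil.
        exact: cst_continuous.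
      have -> : (fun c : 'rV[R[i]]_n => \sum_(i <- j :: s) c 0 i *: e i) =
          (fun c : 'rV[R[i]]_n => c 0 j *: e j + \sum_(i <- s) c 0 i *: e i).
        by apply/funext => d; rewrite big_cons.
      move=> c; apply: (@cvgD _ _ _ (nbhs c) _); last exact: IH.
      apply: (@cvgZr_tmp _ _ _ (nbhs c) _ (fun d : 'rV[R[i]]_n => d 0 j)).
      exact: coord_continuous.
    apply: continuous_subspaceT => c.
    apply: (@continuous_comp _ _ _
      (fun d : 'rV[R[i]]_n => \sum_j d 0 j *: e j)); first exact: sum_cont.
    exact: rnorm_continuous.
  have [c] := compact_EVT_min S0 Sc Sf; rewrite inE => Sci cmin.
  exists (rnorm (\sum_j c 0 j *: e j)); split.
    rewrite lt_neqAle rnorm_ge0 andbT eq_sym; apply/eqP => /rnorm_eq0 c0.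
    have := Sci i; rewrite eqxx /= => ci.
    have h : coord 0 = c by exact: coord_unique.
    have h' : coord 0 = 0.
      by apply: coord_unique; rewrite big1 // => j _; rewrite mxE scale0r.
    by move/eqP: ci; rewrite -h h' mxE eq_sym oner_eq0.
  move=> d di d1; apply: cmin; rewrite inE => j /=.
  case: eqP => [-> //|_] /=; split.
    exact: le_trans (Re_le_rnorm _) (d1 j).
  exact: le_trans (Im_le_rnorm _) (d1 j).
have [k Hk] := choice Hk0.
exists (\sum_i (k i)^-1 + 1) => [|x i].
  by rewrite ltr_wpDl// sumr_ge0// => j _; rewrite invr_ge0 ltW//; case: (Hk j).
have [j _ jmax] := @Order.TotalTheory.arg_maxP _ _ _ i xpredT
  (fun j => rnorm (coord x 0 j)) isT.
rewrite (le_trans (jmax i isT))//.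
have [j0|jN0] := eqVneq (coord x 0 j) 0.
  rewrite j0 rnorm0 mulr_ge0 ?rnorm_ge0// addr_ge0// sumr_ge0// => l _.
  by rewrite invr_ge0 ltW//; case: (Hk l).
have rj : 0 < rnorm (coord x 0 j).
  by rewrite lt_neqAle rnorm_ge0 andbT eq_sym; apply/eqP => /rnorm_eq0/eqP; exact/negP.
have [kj Hj] := Hk j.
have vj : ((coord x 0 j)^-1 *: coord x) 0 j = 1 by rewrite mxE mulVf.
have v1 l : rnorm (((coord x 0 j)^-1 *: coord x) 0 l) <= 1.
  by rewrite mxE rnormM rnormV mulrC ler_pdivrMr// mul1r; exact: jmax.
have suml a : \sum_l (a *: coord x) 0 l *: e l = a *: x.
  rewrite [in RHS](coordE x) scaler_sumr; apply: eq_bigr => l _.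
  by rewrite mxE scalerA.
have := Hj _ vj v1; rewrite suml rnormZ rnormV => kx.
apply: (@le_trans _ _ ((k j)^-1 * rnorm x)).
  by rewrite ler_pdivlMl// mulrC -ler_pdivlMl.
rewrite ler_wpM2r ?rnorm_ge0// (bigD1 j)//= -addrA lerDl addr_ge0// sumr_ge0// => l _.
by rewrite invr_ge0 ltW//; case: (Hk l).
Qed.

Lemma linear_bounded (V : normedModType R[i]) (L : X -> V) : linear L ->
  exists2 K : R, 0 <= K & forall x, rnorm (L x) <= K * rnorm x.
Proof.
move=> linL; have [K K0 HK] := coord_bounded.
exists (K * \sum_i rnorm (L (e i))) => [|x].
  by rewrite mulr_ge0 ?(ltW K0)// sumr_ge0// => i _; exact: rnorm_ge0.
rewrite [in L x](coordE x) lin_sum// (le_trans (rnorm_sum _ _ _))//.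
rewrite mulrAC mulr_sumr; apply: ler_sum => i _.
by rewrite linZ// rnormZ ler_wpM2r ?rnorm_ge0.
Qed.

Lemma linear_continuous_findim (V : normedModType R[i]) (L : X -> V) :
  linear L -> continuous L.
Proof.
move=> linL x; have [K K0 HK] := linear_bounded linL.
apply/cvg_rnormP => d d0; apply/nbhs_rnormP.
have K1 : 0 < K + 1 by rewrite ltr_wpDl.
exists (d / (K + 1)) => [|y yx]; first exact: divr_gt0.
rewrite -linB// (le_lt_trans (HK _))//; rewrite ltr_pdivlMr// mulrC in yx.
by apply: le_lt_trans yx; rewrite ler_wpM2r ?rnorm_ge0// lerDl.
Qed.

End Coordinates.

(** * Riemann integrals of continuous functions *)

Section RealPrimitive.
Variable R : realType.
Local Notation mu := (@lebesgue_measure R).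

(** The mean value theorem for the indefinite integral; [f] is extended to the
    left of [0] by [f 0], so that [0] is an interior point. *)
Lemma real_primitive (f : R -> R) : {within `[0, +oo[, continuous f} ->
  exists2 F : R -> R, F 0 = 0 & forall s t v d, 0 <= s -> s <= t ->
    (forall u, s <= u <= t -> `|f u - v| <= d) ->
    `|F t - F s - (t - s) * v| <= (t - s) * d.
Proof.
move=> fc; pose g (u : R) : R := f (Num.max u 0).
have gc : continuous g.
  move=> x; apply/cvgrPdist_lt => e e0.
  have m0 u : `[0, +oo[%classic (Num.max u 0 : R).
    by rewrite /= in_itv /= andbT le_max lexx orbT.
  move/subspace_continuousP: fc => /(_ _ (m0 x))/cvgrPdist_lt/(_ e e0).
  rewrite /prop_near1 /within /= => /nbhs_ballP[d /= d0 xd].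
  apply/nbhs_ballP; exists d => //= y xy; apply: xd; last exact: m0.
  apply: le_lt_trans xy; rewrite /Num.max.
  by case: ltP => ?; case: ltP => ?; rewrite ?subrr ?normr0//;
    rewrite ler_norml; apply/andP; split;
    have := ler_norm (x - y); have := ler_norm (y - x); rewrite (distrC y); lra.
pose G (x : R) : R := \int[mu]_(u in `[(-1)%R, x]) g u.
have Gd (x : R) : -1 < x -> is_derive x (1 : R) G (g x).
  move=> x1.
  have gi : mu.-integrable `[(-1)%R, x + 1] (EFin \o g).
    apply: continuous_compact_integrable; first exact: segment_compact.
    exact: continuous_subspaceT.
  have xx1 : x < x + 1 by rewrite ltrDl.
  have [dG GE] := continuous_FTC1_closed xx1 gi x1 (gc x).
  by apply: DeriveDef; [exact: dG|rewrite -derive1E].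
exists (fun x => G x - G 0); first by rewrite subrr.
move=> s t v d s0 st fv.
have [x x1|x|c] := @MVT_segment _ G g s t st.
- by apply: Gd; move: x1; rewrite in_itv /= => /andP[]; lra.
- apply: derivable_within_continuous => u; rewrite in_itv /= => /andP[u1 _].
  have : -1 < u by lra.
  by move=> /Gd[].
rewrite in_itv /= => cst E.
have -> : G t - G 0 - (G s - G 0) = G t - G s by ring.
rewrite E mulrC -mulrBr normrM ger0_norm ?subr_ge0// ler_wpM2l ?subr_ge0//.
rewrite /g max_l; last by lra.
exact: fv.
Qed.

End RealPrimitive.

Section Primitive.
Variables (R : realType) (X : normedModType R[i]) (n : nat) (e : 'I_n -> X).
Hypothesis e_basis : is_basis e.
Implicit Types y z : R -> X.

Local Notation continuous_halfline y := {within `[0, +oo[, continuous y}.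

(** Coordinatewise primitives; their error bounds add up to a multiple [K] that
    depends on the basis only. *)
Lemma exists_primitive : exists2 K : R, 0 <= K &
  forall y, continuous_halfline y -> exists2 Y : R -> X, Y 0 = 0 &
    forall s t v d, 0 <= s -> s <= t ->
      (forall u, s <= u <= t -> rnorm (y u - v) <= d) ->
      rnorm (Y t - Y s - (t - s)%:C *: v) <= K * (t - s) * d.
Proof.
have [K K0 HK] := coord_bounded e_basis.
exists (\sum_i 2 * K * rnorm (e i)).
  by apply: sumr_ge0 => i _; rewrite !mulr_ge0 ?rnorm_ge0 ?(ltW K0).
move=> y yc.
pose re i (x : X) := complex.Re (coord e_basis x 0 i).
pose im i (x : X) := complex.Im (coord e_basis x 0 i).
have reB i x x' : re i x - re i x' = complex.Re (coord e_basis (x - x') 0 i).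
  by rewrite /re coordB !mxE; case: (coord _ x 0 i) (coord _ x' 0 i) => ? ? [].
have imB i x x' : im i x - im i x' = complex.Im (coord e_basis (x - x') 0 i).
  by rewrite /im coordB !mxE; case: (coord _ x 0 i) (coord _ x' 0 i) => ? ? [].
have reK i x x' : `|re i x - re i x'| <= K * rnorm (x - x').
  by rewrite reB (le_trans (Re_le_rnorm _)).
have imK i x x' : `|im i x - im i x'| <= K * rnorm (x - x').
  by rewrite imB (le_trans (Im_le_rnorm _)).
have Fre i : exists F : R -> R, F 0 = 0 /\ forall s t v d, 0 <= s -> s <= t ->
    (forall u, s <= u <= t -> `|re i (y u) - v| <= d) ->
    `|F t - F s - (t - s) * v| <= (t - s) * d.
  have [F F0 HF] := real_primitive (lipschitz_within_continuous (reK i) yc).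
  by exists F.
have Fim i : exists F : R -> R, F 0 = 0 /\ forall s t v d, 0 <= s -> s <= t ->
    (forall u, s <= u <= t -> `|im i (y u) - v| <= d) ->
    `|F t - F s - (t - s) * v| <= (t - s) * d.
  have [F F0 HF] := real_primitive (lipschitz_within_continuous (imK i) yc).
  by exists F.
have [F HF] := choice Fre; have [G HG] := choice Fim.
exists (fun t => \sum_i (F i t +i* G i t) *: e i).
  rewrite big1 // => i _; case: (HF i) => -> _; case: (HG i) => -> _.
  by rewrite scale0r.
move=> s t v d s0 st yv.
have -> : \sum_i (F i t +i* G i t) *: e i - \sum_i (F i s +i* G i s) *: e i -
    (t - s)%:C *: v =
  \sum_i ((F i t - F i s - (t - s) * re i v) +i*
          (G i t - G i s - (t - s) * im i v)) *: e i.
  rewrite [in LHS](coordE e_basis v) scaler_sumr -!sumrB.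
  apply: eq_bigr => i _; rewrite scalerA -!scalerBl; congr (_ *: _).
  rewrite /re /im; case: (coord _ v 0 i) => a b /=.
  by apply/eqP; rewrite eq_complex /=; apply/andP; split; apply/eqP; ring.
rewrite (le_trans (rnorm_sum _ _ _))// !mulr_suml; apply: ler_sum => i _.
rewrite rnormZ.
have -> : 2 * K * rnorm (e i) * (t - s) * d =
    ((t - s) * (K * d) + (t - s) * (K * d)) * rnorm (e i) by ring.
rewrite ler_wpM2r ?rnorm_ge0// (le_trans (rnorm_le_ReIm _))//= lerD//.
  case: (HF i) => _; apply => // u ust; rewrite (le_trans (reK _ _ _))//.
  by rewrite ler_wpM2l ?(ltW K0)// yv.
case: (HG i) => _; apply => // u ust; rewrite (le_trans (imK _ _ _))//.
by rewrite ler_wpM2l ?(ltW K0)// yv.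
Qed.

Lemma variation_le_id (t : R) : 0 <= t ->
  variation_le 0 t (fun u => u%:C : R[i]) t.
Proof.
move=> t0 s s0t.
rewrite -[leRHS]subr0 -(partition_telescope id s0t) !big_nat.
apply: ler_sum => j /andP[_ js]; rewrite -rmorphB rnormC ger0_norm//.
by rewrite subr_ge0 ltW// partition_step.
Qed.

Lemma riemann_intE (a b : R) y v : a <= b ->
  is_RS_integral a b (fun t => t%:C) y v -> riemann_int a b y = v.
Proof.
move=> ab yv; apply: (is_RS_integral_unique ab _ yv).
by rewrite /riemann_int; case: xgetP => [w _ //|]; move/(_ v).
Qed.

Lemma primitive_is_RS_integral (K : R) y (Y : R -> X) t : 0 <= K ->
  continuous_halfline y -> Y 0 = 0 ->
  (forall s t v d, 0 <= s -> s <= t ->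
    (forall u, s <= u <= t -> rnorm (y u - v) <= d) ->
    rnorm (Y t - Y s - (t - s)%:C *: v) <= K * (t - s) * d) ->
  0 <= t -> is_RS_integral 0 t (fun t => t%:C) y (Y t).
Proof.
move=> K0 yc Y0 HY t0; rewrite -[Y t]subr0 -Y0.
apply: (is_RS_integral_primitive t0 (variation_le_id t0)) => d d0.
have K1 : 0 < K + 1 by rewrite ltr_wpDl.
have yct : {within `[0, t], continuous y}.
  apply: continuous_subspaceW yc => u /=; rewrite !in_itv /= andbT.
  by case/andP.
have [r r0 Hr] := segment_unif_continuous yct (divr_gt0 d0 K1).
exists r => // s t' x s0 sx xt t't ts.
have st' := le_trans sx xt.
rewrite -rmorphB; apply: (le_trans (HY s t' (y x) (d / (K + 1)) s0 st' _)).
  move=> u /andP[su ut]; rewrite ltW// Hr//; [lra|lra|].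
  by rewrite ltr_norml; lra.
rewrite rnormC ger0_norm ?subr_ge0//.
apply: (@le_trans _ _ (d * (t' - s))); last first.
  by rewrite ler_wpM2l ?(ltW d0)// lerDr subr_ge0.
rewrite mulrAC ler_wpM2r ?subr_ge0// mulrCA ger_pMr//.
by rewrite ler_pdivrMr// mul1r lerDl.
Qed.

Lemma riemann_intP y t : continuous_halfline y -> 0 <= t ->
  is_RS_integral 0 t (fun t => t%:C) y (riemann_int 0 t y).
Proof.
move=> yc t0; have [K K0 HK] := exists_primitive; have [Y Y0 HY] := HK y yc.
have intY := primitive_is_RS_integral K0 yc Y0 HY t0.
by rewrite (riemann_intE t0 intY).
Qed.

Lemma riemann_int_primitive : exists2 K : R, 0 <= K &
  forall y, continuous_halfline y ->
    forall s t v d, 0 <= s -> s <= t ->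
      (forall u, s <= u <= t -> rnorm (y u - v) <= d) ->
      rnorm (riemann_int 0 t y - riemann_int 0 s y - (t - s)%:C *: v) <=
      K * (t - s) * d.
Proof.
have [K K0 HK] := exists_primitive; exists K => // y yc s t v d s0 st yv.
have [Y Y0 HY] := HK y yc.
have intY r (r0 : 0 <= r) :=
  riemann_intE r0 (primitive_is_RS_integral K0 yc Y0 HY r0).
by rewrite (intY s)// (intY t) ?(le_trans s0)//; exact: HY.
Qed.

Lemma riemann_intD y z t : continuous_halfline y -> continuous_halfline z ->
  0 <= t ->
  riemann_int 0 t (fun u => y u + z u) = riemann_int 0 t y + riemann_int 0 t z.
Proof.
by move=> yc zc t0; apply: riemann_intE => //; apply: is_RS_integralD;
  exact: riemann_intP.
Qed.

Lemma riemann_int_linear (L : X -> X) y t : linear L ->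
  continuous_halfline y -> 0 <= t ->
  riemann_int 0 t (L \o y) = L (riemann_int 0 t y).
Proof.
move=> linL yc t0; have [K _ LK] := linear_bounded e_basis linL.
apply: riemann_intE => //; apply: (is_RS_integral_linear linL LK).
exact: riemann_intP.
Qed.

Lemma riemann_int0 y : riemann_int 0 0 y = 0.
Proof.
apply: riemann_intE => // d d0; exists 1 => // s xi [/itv_partitionxx -> _].
by rewrite /RS_sum big_geq// subrr normr0 lecR ltW.
Qed.

Lemma riemann_int_cst y v t : continuous_halfline y -> 0 <= t ->
  (forall u, 0 <= u <= t -> y u = v) -> riemann_int 0 t y = t%:C *: v.
Proof.
move=> yc t0 yv; have [K K0 HK] := riemann_int_primitive.
have := HK y yc 0 t v 0 (lexx 0) t0.
rewrite riemann_int0 !subr0 mulr0 => H; apply/eqP; rewrite -subr_eq0.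
apply/eqP/rnorm_eq0/eqP; rewrite eq_le rnorm_ge0 andbT; apply: H => u u0t.
by rewrite yv// subrr rnorm0.
Qed.

End Primitive.

(** * Primary decomposition in an invariant subspace *)

Section RootSpan.
Variables (F : fieldType) (V : lmodType F) (T : V -> V) (W : V -> Prop).
Hypothesis T_linear : linear T.
Hypothesis W_linear : forall a u v, W u -> W v -> W (a *: u + v).
Hypothesis W_stable : forall v, W v -> W (T v).
Implicit Types (mu la : F) (u v x : V).

Definition shift mu x := T x - mu *: x.

Lemma shift_linear mu : linear (shift mu).
Proof.
move=> a x y; rewrite /shift T_linear scalerDr scalerBr !scalerA mulrC.
by rewrite opprD addrACA.
Qed.

Lemma iter_shift_linear mu k : linear (iter k (shift mu)).
Proof. by elim: k => [//|k IH] a x y /=; rewrite IH shift_linear. Qed.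

Lemma shift_comm mu la x : shift mu (shift la x) = shift la (shift mu x).
Proof.
have shE nu y : shift nu y = (- nu) *: y + T y.
  by rewrite /shift scaleNr addrC.
by rewrite !shE !T_linear !scalerDr !scalerA mulrC -!addrA; congr (_ + _);
  rewrite addrCA.
Qed.

Lemma iter_shift_comm mu la k x :
  iter k (shift la) (shift mu x) = shift mu (iter k (shift la) x).
Proof. by elim: k => [//|k IH] /=; rewrite IH shift_comm. Qed.

Lemma subspace_shift mu x : W x -> W (shift mu x).
Proof.
by move=> Wx; rewrite /shift addrC -scaleNr; apply: W_linear => //; exact: W_stable.
Qed.

Lemma subspaceD u v : W u -> W v -> W (u + v).
Proof. by move=> Wu Wv; rewrite -[u]scale1r; exact: W_linear. Qed.

Lemma subspaceB u v : W u -> W v -> W (u - v).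
Proof. by move=> Wu Wv; rewrite addrC -scaleN1r; exact: W_linear. Qed.

(** Asking the summands to lie in the invariant subspace [W] is what hands a
    property of a vector, such as the boundedness of a solution, on to its
    components. *)
Inductive root_span : V -> Prop :=
| root_span_root mu k v : W v -> iter k (shift mu) v = 0 -> root_span v
| root_span_add u v : root_span u -> root_span v -> root_span (u + v).

Lemma root_span_W x : root_span x -> W x.
Proof. by elim=> // u v _ Wu _ Wv; exact: subspaceD. Qed.

(** [T - mu] is onto from the root space of [la != mu], and within [W]: there
    [T - mu] is the sum of the scalar [la - mu] and of a nilpotent map. *)
Lemma shift_root_onto mu la k v : la != mu -> W v -> iter k (shift la) v = 0 ->
  exists u, [/\ W u, iter k (shift la) u = 0 & v = shift mu u].
Proof.
move=> lamu; elim: k v => [|k IH] v Wv.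
  move=> /= v0; exists v; split => //.
  by rewrite v0 (lin0 (shift_linear mu)).
rewrite iterSr => /(IH _ (subspace_shift la Wv))[u [Wu u0 vu]].
have lamu0 : la - mu != 0 by rewrite subr_eq0.
exists ((la - mu)^-1 *: (v - u)); split.
- rewrite -[_ *: _]addr0; apply: W_linear; first exact: subspaceB.
  by rewrite -(subrr v); exact: subspaceB.
- rewrite iterSr (linZ (shift_linear la)) (linZ (iter_shift_linear la k)).
  rewrite (linB (shift_linear la)) (linB (iter_shift_linear la k)).
  by rewrite vu !iter_shift_comm u0 !(lin0 (shift_linear _)) subrr scaler0.
- rewrite (linZ (shift_linear mu)) (linB (shift_linear mu)) -vu /shift.
  rewrite opprB [X in _ *: X]addrC addrA subrK -scalerBl scalerA mulVf//.
  by rewrite scale1r.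
Qed.

(** The components at [la != mu] are in the image of [T - mu]; those at [mu]
    make up [v]. *)
Lemma root_span_split mu x : root_span x -> exists u v k,
  [/\ root_span u, W v, iter k (shift mu) v = 0 & x = shift mu u + v].
Proof.
elim=> [la k v Wv v0|x1 x2 _ [u1 [v1 [k1 [Su1 Wv1 v10 ->]]]]
    _ [u2 [v2 [k2 [Su2 Wv2 v20 ->]]]]].
  have W0 : W 0 by rewrite -(subrr v); exact: subspaceB.
  have [lamu|lamu] := eqVneq la mu.
    exists 0, v, k; split => //; last by rewrite (lin0 (shift_linear mu)) add0r.
      by apply: (@root_span_root mu 0).
    by rewrite -lamu.
  have [u [Wu u0 vu]] := shift_root_onto lamu Wv v0.
  exists u, 0, 0%N; split => //; first exact: root_span_root Wu u0.
  by rewrite addr0.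
exists (u1 + u2), (v1 + v2), (k1 + k2)%N; split.
- exact: root_span_add.
- exact: subspaceD.
- rewrite (linD (iter_shift_linear _ _)) [in X in X + _]addnC !iterD v10 v20.
  by rewrite !(lin0 (iter_shift_linear _ _)) addr0.
- by rewrite (linD (shift_linear mu)) addrACA.
Qed.

(** If [(T - mu) x = (T - mu) u + v] with [v] in the root space of [mu], then so
    is [x - u]. *)
Lemma root_span_shift mu x : W x -> root_span (shift mu x) -> root_span x.
Proof.
move=> Wx /(root_span_split mu)[u [v [k [Su Wv v0 E]]]].
rewrite -(subrKC u x); apply: root_span_add => //.
apply: (@root_span_root mu k.+1); first by apply: subspaceB => //; exact: root_span_W.
by rewrite iterSr (linB (shift_linear mu)) E addrC addKr.
Qed.

(** Primary decomposition, by dividing out one factor [T - mu] at a time. *)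
Lemma root_span_annihilated (s : seq F) x : W x -> foldr shift x s = 0 ->
  root_span x.
Proof.
move=> Wx s0.
have : root_span (foldr shift x s).
  rewrite s0; apply: (@root_span_root 0 0) => //.
  by rewrite -(subrr x); exact: subspaceB.
elim: s {s0} => [//|mu s IH] /= H; apply: IH; apply: root_span_shift H.
by elim: s => [//|la s IH] /=; exact: subspace_shift.
Qed.

End RootSpan.

(** * The spectral projection on root vectors *)

Section OperatorIntegral.
Variables (R : realType) (X : normedModType R[i]) (n : nat) (e : 'I_n -> X).
Hypothesis e_basis : is_basis e.

Lemma RS_sum_linear (a b : R) (g : R -> R[i]) (F : R -> X -> X) d s xi :
  (forall t, a <= t <= b -> linear (F t)) -> tagged_partition a b d s xi ->
  linear (fun x => RS_sum a b g (F^~ x) s xi).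
Proof.
move=> linF tp k x y; rewrite /RS_sum scaler_sumr -big_split !big_nat /=.
apply: eq_bigr => j js; rewrite linF ?(tag_mem tp js)//.
by rewrite scalerDr !scalerA mulrC.
Qed.

Lemma is_RS_integral_op_pointwise (a b : R) (g : R -> R[i]) (F : R -> X -> X)
    (J : X -> X) x :
  is_RS_integral_op a b g F J -> is_RS_integral a b g (F^~ x) (J x).
Proof.
move=> FJ; apply/is_RS_integralP => d d0.
have x1 : 0 < rnorm x + 1 by rewrite ltr_wpDl// rnorm_ge0.
have [r r0 H] := FJ _ (divr_gt0 d0 x1); exists r => // s xi /H/(_ x).
rewrite !rnormE -rmorphM lecR => /le_trans; apply.
by rewrite mulrAC ler_pdivrMr// ler_wpM2l ?(ltW d0)// lerDl.
Qed.

(** The error at [x] is a combination of the errors on the basis, with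
    coefficients bounded by the norm of [x]. *)
Lemma exists_RS_integral_op (a b : R) (g : R -> R[i]) (F : R -> X -> X) :
  (forall t, a <= t <= b -> linear (F t)) ->
  (forall x, exists v, is_RS_integral a b g (F^~ x) v) ->
  exists J, is_RS_integral_op a b g F J.
Proof.
move=> linF FJ; have [J HJ] := choice (fun i => FJ (e i)).
exists (fun x => \sum_i coord e_basis x 0 i *: J i) => d d0.
have [K K0 HK] := coord_bounded e_basis.
pose c := d / (K * n%:R + 1).
have c1 : 0 < K * n%:R + 1 by rewrite ltr_wpDl// mulr_ge0// ltW.
have [r Hr] : exists r : 'I_n -> R, forall i, 0 < r i /\
    forall s xi, tagged_partition a b (r i) s xi ->
    rnorm (RS_sum a b g (F^~ (e i)) s xi - J i) <= c.
  have Hi i : exists r : R, 0 < r /\ forall s xi, tagged_partition a b r s xi ->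
      rnorm (RS_sum a b g (F^~ (e i)) s xi - J i) <= c.
    have [r r0 H] := (is_RS_integralP _ _ _ _ _).1 (HJ i) c (divr_gt0 d0 c1).
    by exists r.
  by have [r Hr] := choice Hi; exists r.
have ri i : 0 <= (r i)^-1 by rewrite invr_ge0 ltW//; case: (Hr i).
have rs0 : 0 < \sum_i (r i)^-1 + 1 by rewrite ltr_wpDl// sumr_ge0.
(* a lower bound of the finitely many [r i] *)
exists (\sum_i (r i)^-1 + 1)^-1 => [|s xi tp x]; first by rewrite invr_gt0.
rewrite !rnormE -rmorphM lecR.
have -> : RS_sum a b g (F^~ x) s xi =
    \sum_i coord e_basis x 0 i *: RS_sum a b g (F^~ (e i)) s xi.
  have linS := RS_sum_linear g linF tp.
  rewrite -[LHS]/((fun x => RS_sum a b g (F^~ x) s xi) x).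
  rewrite {1}(coordE e_basis x) (lin_sum linS).
  by apply: eq_bigr => i _; rewrite (linZ linS).
rewrite -sumrB (le_trans (rnorm_sum _ _ _))//.
apply: (@le_trans _ _ (\sum_(i < n) K * rnorm x * c)).
  apply: ler_sum => i _; rewrite -scalerBr rnormZ.
  apply: ler_pM; rewrite ?rnorm_ge0//; have [ri0 H] := Hr i; apply: H.
  apply: tagged_partition_le tp; rewrite -[leRHS]invrK lef_pV2 ?posrE ?invr_gt0//.
  by rewrite (bigD1 i)//= -addrA lerDl addr_ge0// sumr_ge0.
rewrite sumr_const card_ord -mulr_natr.
have -> : K * rnorm x * c * n%:R = d * rnorm x * ((K * n%:R) / (K * n%:R + 1)).
  by rewrite /c; field; rewrite gt_eqF.
rewrite ler_piMr ?mulr_ge0 ?rnorm_ge0 ?(ltW d0)//.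
by rewrite ler_pdivrMr// mul1r lerDl.
Qed.

End OperatorIntegral.

Section SpectralProjection.
Variables (R : realType) (X : normedModType R[i]) (n : nat) (e : 'I_n -> X).
Hypothesis e_basis : is_basis e.
Variable A : {linear X -> X}.
Implicit Types (z mu : R[i]) (x v : X).

Lemma A_linear : linear A.
Proof. exact: linearP. Qed.

Lemma resolventP z : resolvent_set A z -> is_resolvent A z (resolvent A z).
Proof. by move=> [B HB]; exact: (xgetPex (fun=> 0) (ex_intro _ B HB)). Qed.

Lemma resolvent_set_inj z v : resolvent_set A z -> shift A z v = 0 -> v = 0.
Proof.
move=> [B [linB _ AB _]] v0; rewrite -(AB v).
by rewrite -[A v - _]/(shift A z v) v0 (lin0 linB).
Qed.

(** The roots of the characteristic polynomial, with multiplicity: the first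
    property is the theorem of Cayley and Hamilton. *)
Lemma exists_char_roots : (0 < n)%N -> exists s : seq R[i],
  (forall x, foldr (shift A) x s = 0) /\
  (forall z, z \notin s -> resolvent_set A z).
Proof.
case: n e e_basis => [//|m] f f_basis _.
pose M : 'M[R[i]]_m.+1 := \matrix_(i, j) coord f_basis (A (f i)) 0 j.
have coordA x : coord f_basis (A x) = coord f_basis x *m M.
  apply/rowP => j; rewrite [in LHS](coordE f_basis x) linear_sum.
  rewrite (lin_sum (coord_linear f_basis)) summxE mxE; apply: eq_bigr => i _.
  by rewrite linearZ (linZ (coord_linear f_basis)) !mxE.
have [s sM] := closed_field_poly_normal (char_poly M).
rewrite (monicP (char_poly_monic M)) scale1r in sM.
exists s; split=> [x|z zs].
  apply: (coord_inj (e_basis := f_basis)).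
  suff -> : coord f_basis (foldr (shift A) x s) =
      coord f_basis x *m horner_mx M (\prod_(mu <- s) ('X - mu%:P)).
    by rewrite -sM Cayley_Hamilton mulmx0 (lin0 (coord_linear f_basis)).
  elim: (s) => [|mu t IH] /=; first by rewrite big_nil rmorph1 mulmx1.
  rewrite big_cons mulrC rmorphM /= mulmxA -IH rmorphB /= horner_mx_X horner_mx_C.
  rewrite /shift (linB (coord_linear f_basis)) (linZ (coord_linear f_basis)).
  by rewrite coordA mulmxBr mul_mx_scalar.
have Mz : M - z%:M \in unitmx.
  rewrite -row_free_unit -kermx_eq0; apply/negPn/negP => h.
  have : eigenvalue M z by [].
  by rewrite eigenvalue_root_char sM root_prod_XsubC (negPf zs).
pose B x := \sum_i (coord f_basis x *m invmx (M - z%:M)) 0 i *: f i.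
have coordB' x : coord f_basis (B x) = coord f_basis x *m invmx (M - z%:M).
  exact: coord_unique.
have coordAz x : coord f_basis (A x - z *: x) = coord f_basis x *m (M - z%:M).
  by rewrite coordB coordA (linZ (coord_linear f_basis)) mulmxBr mul_mx_scalar.
have linB' : linear B.
  move=> a x y; apply: (coord_inj (e_basis := f_basis)).
  by rewrite (coord_linear f_basis) !coordB' (coord_linear f_basis) mulmxDl scalemxAl.
exists B; split => //.
- exact: (linear_continuous_findim f_basis).
- by move=> x; apply: (coord_inj (e_basis := f_basis)); rewrite coordB' coordAz mulmxK.
- by move=> x; apply: (coord_inj (e_basis := f_basis)); rewrite coordAz coordB' mulmxKV.
Qed.

(** On a root vector the resolvent is the polynomial
    [- sum_j (zeta - mu)^-(j + 1) (A - mu)^j] in [(zeta - mu)^-1]; only its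
    term in [(zeta - mu)^-1] has a non-zero contour integral. *)
Lemma resolvent_root_integral (gamma : R -> R[i]) (M : R) mu w k v :
  {within `[0, 1], continuous gamma} -> gamma 0 = gamma 1 ->
  variation_le 0 1 gamma M ->
  contour_trace gamma `<=` resolvent_set A -> ~ contour_trace gamma mu ->
  is_RS_integral 0 1 gamma (fun t => (gamma t - mu)^-1) w ->
  iter k (shift A mu) v = 0 ->
  is_RS_integral 0 1 gamma (fun t => resolvent A (gamma t) v) (- w *: v).
Proof.
move=> gc g01 gM gA gmu gw.
have in_trace t : 0 <= t <= 1 -> contour_trace gamma (gamma t).
  by move=> t01; exists t => //; rewrite /= in_itv.
suff main k' : forall j v', iter k' (shift A mu) v' = 0 ->
    is_RS_integral 0 1 gamma
      (fun t => (gamma t - mu)^-1 ^+ j *: resolvent A (gamma t) v')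
      (if j is 0%N then - w *: v' else 0).
  move=> v0; have := main k 0%N v v0; apply: eq_is_RS_integral => t _.
  by rewrite expr0 scale1r.
elim: k' => [|k' IH] j v' v0.
  have -> : v' = 0 by [].
  have -> : (if j is 0%N then - w *: (0 : X) else 0) = 0.
    by case: j => //; rewrite scaler0.
  apply: eq_is_RS_integral (is_RS_integral0 _ _ _ _) => t t01.
  have [linR _ _ _] := resolventP (gA _ (in_trace t t01)).
  by rewrite (lin0 linR) scaler0.
rewrite iterSr in v0.
have I1 := IH j.+1 _ v0.
have I2 : is_RS_integral 0 1 gamma (fun t => (gamma t - mu)^-1 ^+ j.+1 *: v')
    ((if j is 0%N then w else 0) *: v').
  case: (j) => [|j'].
    apply: is_RS_integral_scale; apply: eq_is_RS_integral gw => t _.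
    by rewrite expr1.
  by apply: is_RS_integral_scale; exact: (inv_power_vanishing gc g01 gM).
have := is_RS_integralD I1 (is_RS_integralZ (-1) I2).
have -> : 0 + -1 *: ((if j is 0%N then w else 0) *: v') =
    (if j is 0%N then - w *: v' else 0).
  by case: (j) => [|j']; rewrite add0r scaleN1r ?scaleNr// scale0r oppr0.
apply: eq_is_RS_integral => t t01.
have [linR _ AR _] := resolventP (gA _ (in_trace t t01)).
have gN0 : gamma t - mu != 0.
  apply/eqP => /eqP; rewrite subr_eq0 => /eqP gt; apply: gmu.
  by rewrite -gt; exact: in_trace.
(* [A - mu = (A - zeta) + (zeta - mu)] *)
have -> : shift A mu v' = (A v' - gamma t *: v') + (gamma t - mu) *: v'.
  by rewrite /shift scalerBl addrA subrK.
rewrite (linD linR) AR (linZ linR) scalerDr scalerA exprS mulrAC mulVf// mul1r.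
by rewrite scaleN1r addrC addKr.
Qed.

(** Either [A - mu] is injective and [v = 0], or [mu] is in the spectrum; the
    contour then winds once around [mu = 0] and does not enclose [mu != 0]. *)
Lemma isolating_root_integral (gamma : R -> R[i]) mu k v :
  isolating_contour A 0 gamma -> iter k (shift A mu) v = 0 ->
  is_RS_integral 0 1 gamma (fun t => resolvent A (gamma t) v)
    (- (if mu == 0 then 2 * pi%:C * 'i else 0) *: v).
Proof.
move=> [[gc g01 _ [M gM]] gpos g0 gA gI] v0.
have {}gM : variation_le 0 1 gamma M.
  move=> s /gM; rewrite -lecR rmorph_sum /=; apply: le_trans.
  by rewrite le_eqVlt; apply/orP; left; apply/eqP/eq_bigr => j _; rewrite rnormE.
have [muA|muA] := pselect (resolvent_set A mu).
  have -> : v = 0.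
    elim: k v0 => [//|k IH]; rewrite iterS => /(resolvent_set_inj muA).
    exact: IH.
  rewrite scaler0; apply: eq_is_RS_integral (is_RS_integral0 _ _ _ _) => t t01.
  have [|linR _ _ _] := @resolventP (gamma t).
    by apply: gA; exists t => //; rewrite /= in_itv.
  by rewrite (lin0 linR).
have mut : ~ contour_trace gamma mu by move/gA.
apply: (resolvent_root_integral gc g01 gM gA mut) v0.
have [mu0|mu0] := eqVneq mu 0; first by rewrite mu0; exact: gpos.
apply: (outside_vanishing gc g01 gM mut) => mui; apply: muA.
by apply: gI; split => //=; exact/eqP.
Qed.

Hypothesis n_gt0 : (0 < n)%N.

Lemma root_span_all (W : X -> Prop) :
  (forall a u v, W u -> W v -> W (a *: u + v)) -> (forall v, W v -> W (A v)) ->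
  forall x, W x -> root_span A W x.
Proof.
move=> WL WA x Wx; have [s [s0 _]] := exists_char_roots n_gt0.
exact: (root_span_annihilated A_linear WL WA Wx (s0 x)).
Qed.

(** The spectrum is finite, so the radius can be taken below the moduli of its
    non-zero points. *)
Lemma exists_isolating_circle : exists2 r : R, 0 < r &
  isolating_contour A 0 (circle r).
Proof.
have [s [_ sA]] := exists_char_roots n_gt0.
have [r r0 rs] : exists2 r : R, 0 < r &
    forall mu, mu \in s -> mu != 0 -> r < rnorm mu.
  elim: s {sA} => [|mu s [r r0 IH]]; first by exists 1.
  have [->|mu0] := eqVneq mu 0.
    exists r => // nu; rewrite inE => /predU1P[->|]; first by rewrite eqxx.
    exact: IH.
  have m0 : 0 < rnorm mu.
    rewrite lt_neqAle rnorm_ge0 andbT eq_sym.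
    by apply/eqP => /rnorm_eq0/eqP; exact/negP.
  exists (Num.min r (rnorm mu / 2)); first by rewrite lt_min r0 divr_gt0.
  move=> nu; rewrite inE => /predU1P[->|nus] nu0; rewrite gt_min.
    by apply/orP; right; rewrite ltr_pdivrMr// ltr_pMr// ltr1n.
  by rewrite IH.
exists r => //; split.
- exact: circle_jordan.
- exact: circle_positive.
- exact: inside_circle0.
- move=> z /(circle_trace r0) zr; apply: sA; apply/negP => /rs.
  rewrite zr ltxx => H; suff /H : z != 0 by [].
  by apply/eqP => z0; move: r0; rewrite -zr z0 rnorm0 ltxx.
- move=> z [/(inside_circle_lt r0) zr /eqP z0]; apply: sA; apply/negP => /rs.
  by move=> /(_ z0) /(lt_trans zr); rewrite ltxx.
Qed.

(** The defining integral over a small circle exists on every root vector,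
    hence on every vector, and then in the operator norm. *)
Lemma spectral_projectionP :
  is_spectral_projection A 0 (spectral_projection A 0).
Proof.
have [r r0 iso] := exists_isolating_circle.
have [_ _ _ gA _] := iso.
have linR t : 0 <= t <= 1 -> linear ((resolvent A \o circle r) t).
  move=> t01; have [|//] := @resolventP (circle r t).
  by apply: gA; exists t => //; rewrite /= in_itv.
have [|J HJ] := exists_RS_integral_op e_basis (g := circle r) linR.
  move=> x; have := @root_span_all (fun=> True) _ _ x I.
  move=> /(_ (fun _ _ _ _ _ => I) (fun _ _ => I)).
  elim=> [mu k v _ v0|u v _ [u' Hu] _ [v' Hv]].
    eexists; exact: (isolating_root_integral iso v0).
  exists (u' + v'); apply: eq_is_RS_integral (is_RS_integralD Hu Hv) => t t01.
  by rewrite (linD (linR t t01)).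
apply: (xgetPex (fun=> 0)).
by exists (fun x => - (2 * pi%:C * 'i)^-1 *: J x), (circle r), J.
Qed.

Lemma spectral_projectionD x v : spectral_projection A 0 (x + v) =
  spectral_projection A 0 x + spectral_projection A 0 v.
Proof.
have [gamma [J [[_ _ _ gA _] HJ ->]]] := spectral_projectionP.
rewrite -scalerDr; congr (_ *: _).
have Jp y := is_RS_integral_op_pointwise y HJ.
apply: (is_RS_integral_unique ler01 (Jp _)).
apply: eq_is_RS_integral (is_RS_integralD (Jp x) (Jp v)) => t t01 /=.
have [|linR _ _ _] := @resolventP (gamma t).
  by apply: gA; exists t => //; rewrite /= in_itv.
by rewrite (linD linR).
Qed.

Lemma spectral_projection_root mu k v : iter k (shift A mu) v = 0 ->
  spectral_projection A 0 v = if mu == 0 then v else 0.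
Proof.
move=> v0; have [gamma [J [iso HJ ->]]] := spectral_projectionP.
have := isolating_root_integral iso v0.
move/(is_RS_integral_unique ler01 (is_RS_integral_op_pointwise v HJ)) => ->.
have pi0 : (2 * pi%:C * 'i : R[i]) != 0.
  rewrite !mulf_neq0 ?neq0Ci ?pnatr_eq0//.
  by rewrite eq_complex /= eqxx andbT gt_eqF// pi_gt0.
case: eqP => _; last by rewrite oppr0 scale0r scaler0.
by rewrite scalerA mulrNN mulVf// scale1r.
Qed.

End SpectralProjection.

(** * Decay along arithmetic progressions *)

Section DiscreteDecay.
Variables (R : realType) (g : R -> R) (a B C : R).
Hypotheses (a0 : 0 < a) (C0 : 0 <= C).
Hypothesis g_ge0 : forall t, 0 <= t -> 0 <= g t.
Hypothesis g_le : forall t, 0 <= t -> g t <= B.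

Lemma step_size (eps : R) : 0 < eps ->
  exists h, [/\ 0 < h, h <= 1, a * h <= 1 & C * h <= eps].
Proof.
move=> e0; have C1 : 0 < C + 1 by rewrite ltr_wpDl.
exists (Num.min 1 (Num.min a^-1 (eps / (C + 1)))); split.
- by rewrite !lt_min ltr01 invr_gt0 a0 divr_gt0.
- by rewrite ge_min lexx.
- by rewrite -ler_pdivlMl// mulr1 !ge_min lexx orbT.
- have : Num.min 1 (Num.min a^-1 (eps / (C + 1))) <= eps / (C + 1).
    by rewrite !ge_min lexx !orbT.
  rewrite ler_pdivlMr// mulrC mulrDl mul1r; apply: le_trans.
  by rewrite lerDl !le_min ler01 invr_ge0 (ltW a0) divr_ge0// ltW.
Qed.

Lemma exists_nat_gt (c d : R) : 0 < d -> exists k : nat, c < k%:R * d.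
Proof.
move=> d0; exists (Num.truncn (c / d)).+1.
by rewrite -ltr_pdivrMr// truncnS_gt.
Qed.

(** A value above the threshold would grow linearly along the progression of
    step [h], against boundedness. *)
Lemma decay_of_expansion :
  (forall eps, 0 < eps -> exists2 T, 0 <= T & forall t h, T <= t ->
     0 < h <= 1 -> (1 + a * h) * g t <= g (t + h) + h * eps + C * h ^+ 2) ->
  forall eps, 0 < eps -> exists T, forall t, T <= t -> g t <= eps.
Proof.
move=> H eps e0; pose d := a * eps / 4.
have d0 : 0 < d by rewrite !mulr_gt0// invr_gt0.
have [T T0 HT] := H d d0; exists T => t Tt.
have [h [h0 h1 _ hC]] := step_size d0.
rewrite leNgt; apply/negP => gt.
(* above [eps] the main term [a h eps] is [4 h d], twice the error of a step,
   so that each step changes the value by at least [2 h d] *)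
have hd : 0 < 2 * h * d by rewrite !mulr_gt0.
have [k kB] := exists_nat_gt B hd.
suff grow m : eps + m%:R * (2 * h * d) <= g (t + m%:R * h).
  have tk0 : 0 <= t + k%:R * h.
    by apply: addr_ge0; [exact: le_trans Tt|rewrite mulr_ge0// ltW].
  by have := grow k; have := g_le tk0; lra.
elim: m => [|m IH]; first by rewrite !mul0r !addr0 ltW.
have Tm : T <= t + m%:R * h.
  by rewrite (le_trans Tt)// lerDl mulr_ge0// ltW.
have h01 : 0 < h <= 1 by rewrite h0.
have := HT _ h Tm h01.
have -> : t + m.+1%:R * h = t + m%:R * h + h by rewrite -natr1; ring.
have gm : eps <= g (t + m%:R * h).
  by apply: le_trans IH; rewrite lerDl mulr_ge0// ltW.
have ahg : a * h * eps <= a * h * g (t + m%:R * h).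
  by rewrite ler_wpM2l// mulr_ge0// ltW.
have hhC : C * h ^+ 2 <= d * h by rewrite expr2 mulrA ler_wpM2r// ltW.
have -> : eps + m.+1%:R * (2 * h * d) = eps + m%:R * (2 * h * d) + 2 * h * d.
  by rewrite -natr1; ring.
have de : a * h * eps = 4 * d * h by rewrite /d; field.
lra.
Qed.

(** Above the threshold the values decrease linearly along the progression of
    step [h]; below it they stay. *)
Lemma decay_of_contraction :
  (forall eps, 0 < eps -> exists2 T, 0 <= T & forall t h, T <= t ->
     0 < h <= 1 -> g (t + h) <= (1 - a * h) * g t + h * eps + C * h ^+ 2) ->
  forall eps, 0 < eps -> exists T, forall t, T <= t -> g t <= eps.
Proof.
move=> H eps e0; pose d := a * eps / 4.
have d0 : 0 < d by rewrite !mulr_gt0// invr_gt0.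
have [T T0 HT] := H d d0.
have [h [h0 h1 ah hC]] := step_size d0.
have hd : 0 < 2 * h * d by rewrite !mulr_gt0.
have [k kB] := exists_nat_gt B hd.
(* after [k] steps a value above [eps] would be negative *)
exists (T + k%:R * h) => t Tt.
have Ts : T <= t - k%:R * h by rewrite lerBrDr.
have shrink m : g (t - k%:R * h + m%:R * h) <= eps \/
    g (t - k%:R * h + m%:R * h) <= B - m%:R * (2 * h * d).
  elim: m => [|m IH].
    by right; rewrite !mul0r addr0 subr0; apply: g_le; exact: le_trans Ts.
  set s := t - k%:R * h + m%:R * h in IH.
  have Tm : T <= s by rewrite (le_trans Ts)// lerDl mulr_ge0// ltW.
  have h01 : 0 < h <= 1 by rewrite h0.
  have := HT _ h Tm h01.
  have -> : t - k%:R * h + m.+1%:R * h = s + h by rewrite /s -natr1; ring.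
  have -> : B - m.+1%:R * (2 * h * d) = B - m%:R * (2 * h * d) - 2 * h * d.
    by rewrite -natr1; ring.
  have hhC : C * h ^+ 2 <= d * h by rewrite expr2 mulrA ler_wpM2r// ltW.
  have de : a * h * eps = 4 * d * h by rewrite /d; field.
  have dh : 0 < d * h by rewrite mulr_gt0.
  have [ge|ge] := lerP (g s) eps.
    have : (1 - a * h) * g s <= (1 - a * h) * eps.
      by rewrite ler_wpM2l// subr_ge0.
    by left; lra.
  have : a * h * eps <= a * h * g s by rewrite ler_wpM2l ?mulr_ge0 ?ltW.
  case: IH => [/(lt_le_trans ge)|IH]; first by rewrite ltxx.
  by right; lra.
have := shrink k; rewrite subrK => -[//|gk].
have t0 : 0 <= t.
  by apply: le_trans Tt; rewrite addr_ge0// mulr_ge0// ltW.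
by have := g_ge0 t0; lra.
Qed.

End DiscreteDecay.

(** * Bounded solutions *)

Section BoundedSolutions.
Variables (R : realType) (X : normedModType R[i]) (n : nat) (e : 'I_n -> X).
Hypothesis e_basis : is_basis e.
Variable A : {linear X -> X}.
Implicit Types (y z u : R -> X) (mu : R[i]).

Definition bounded_solution y := weak_solution A y /\ bounded_on_halfline y.

Lemma bounded_solution_cont y : bounded_solution y ->
  {within `[0, +oo[, continuous y}.
Proof. by case=> -[]. Qed.

Lemma bounded_solutionE y t : bounded_solution y -> 0 <= t ->
  y t = y 0 + A (riemann_int 0 t y).
Proof. by case=> -[_ yE] _; exact: yE. Qed.

Lemma bounded_solution_bound y : bounded_solution y ->
  exists2 B : R, 0 <= B & forall t, 0 <= t -> rnorm (y t) <= B.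
Proof.
case=> _ /bounded_rnormP[B HB]; exists (`|B|) => // t t0.
apply: (le_trans (HB _ _) (ler_norm B)); exists t => //.
by rewrite /= in_itv /= t0.
Qed.

Lemma within_continuousZD (D : set R) a y z : {within D, continuous y} ->
  {within D, continuous z} -> {within D, continuous (a *: y + z)}.
Proof.
move=> yc zc t; apply: cvgD; last exact: zc.
by apply: cvgZl_tmp; exact: yc.
Qed.

Lemma riemann_intZ a y t : {within `[0, +oo[, continuous y} -> 0 <= t ->
  riemann_int 0 t (a *: y) = a *: riemann_int 0 t y.
Proof.
move=> yc t0; apply: riemann_intE => //; apply: is_RS_integralZ.
exact: (riemann_intP e_basis).
Qed.

Lemma bounded_solution_linear a y z : bounded_solution y ->
  bounded_solution z -> bounded_solution (a *: y + z).
Proof.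
move=> Sy Sz; have [B B0 yB] := bounded_solution_bound Sy.
have [D D0 zD] := bounded_solution_bound Sz.
have yc := bounded_solution_cont Sy; have zc := bounded_solution_cont Sz.
have ayc : {within `[0, +oo[, continuous (a *: y)}.
  by move=> t; apply: cvgZl_tmp; exact: yc.
split; first split.
- exact: within_continuousZD.
- move=> t t0; rewrite (riemann_intD e_basis ayc zc t0) riemann_intZ//.
  rewrite linearD linearZ addrACA -scalerDr.
  by rewrite -(bounded_solutionE Sy t0) -(bounded_solutionE Sz t0).
- apply/bounded_rnormP; exists (rnorm a * B + D) => _ [t /= + <-].
  rewrite in_itv /= andbT => t0; rewrite (le_trans (rnormD _ _))// lerD ?zD//.
  by rewrite rnormZ ler_wpM2l ?rnorm_ge0// yB.
Qed.

Lemma bounded_solution_A y : bounded_solution y -> bounded_solution (A \o y).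
Proof.
move=> Sy; have [B B0 yB] := bounded_solution_bound Sy.
have yc := bounded_solution_cont Sy.
have [K K0 AK] := linear_bounded e_basis (A_linear A).
split; first split.
- move=> t; apply: cvg_comp; first exact: yc.
  exact: (linear_continuous_findim e_basis (A_linear A)).
- move=> t t0; rewrite /= (riemann_int_linear e_basis (A_linear A) yc t0).
  by rewrite (bounded_solutionE Sy t0) linearD.
- apply/bounded_rnormP; exists (K * B) => _ [t /= + <-].
  rewrite in_itv /= andbT => t0; rewrite (le_trans (AK _))//.
  by rewrite ler_wpM2l ?yB.
Qed.

Lemma comp_linear : linear (fun y => A \o y).
Proof. by move=> a y z; apply/funext => t /=; rewrite linearP. Qed.

Lemma iter_shift_comp mu k y t :
  iter k (shift (fun y => A \o y) mu) y t = iter k (shift A mu) (y t).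
Proof. by elim: k t => [//|k IH] t /=; rewrite -IH. Qed.

(** The decomposition is that of functions: the components of a bounded solution
    are bounded solutions, not only values at a given time. *)
Lemma solution_root_span y : (0 < n)%N -> bounded_solution y ->
  root_span (fun y => A \o y) bounded_solution y.
Proof.
move=> n_gt0 Sy; have [s [s0 _]] := exists_char_roots e_basis A n_gt0.
apply: (root_span_annihilated comp_linear bounded_solution_linear
  bounded_solution_A Sy (s := s)).
apply/funext => t; rewrite -[RHS](s0 (y t)).
by elim: s t {s0} => [//|mu s IH] t /=; rewrite -IH.
Qed.

(** If [A^2 y = 0] then [y t = y 0 + t A (y 0)], so that boundedness forces
    [A (y 0) = 0]; higher nilpotency orders reduce to this one. *)
Lemma nilpotent_solution_const k y : bounded_solution y ->
  (forall t, 0 <= t -> iter k (shift A 0) (y t) = 0) ->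
  forall t, 0 <= t -> y t = y 0.
Proof.
move=> Sy yk.
suff Ay0 : forall t, 0 <= t -> A (y t) = 0.
  move=> t t0; rewrite (bounded_solutionE Sy t0).
  rewrite -(riemann_int_linear e_basis (A_linear A) (bounded_solution_cont Sy) t0).
  rewrite (riemann_int_cst (v := 0) e_basis) ?scaler0 ?addr0//.
    exact: (bounded_solution_cont (bounded_solution_A Sy)).
  by move=> u /andP[u0 _]; exact: Ay0.
elim: k y Sy yk => [|k IH] y Sy yk t t0; first by rewrite [y t](yk t t0) linear0.
have Sz := bounded_solution_A Sy; have zc := bounded_solution_cont Sz.
have Az0 : forall t, 0 <= t -> A ((A \o y) t) = 0.
  apply: IH => // u u0; have := yk u u0.
  by rewrite iterSr {2}/shift scale0r subr0.
have zE (r : R) : 0 <= r -> A (y r) = A (y 0).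
  move=> r0; rewrite -[LHS]/((A \o y) r) (bounded_solutionE Sz r0).
  rewrite -(riemann_int_linear e_basis (A_linear A) zc r0).
  rewrite (riemann_int_cst (v := 0) e_basis) ?scaler0 ?addr0//.
    exact: (bounded_solution_cont (bounded_solution_A Sz)).
  by move=> w /andP[w0 _]; exact: Az0.
have yE (r : R) : 0 <= r -> y r = y 0 + r%:C *: A (y 0).
  move=> r0; rewrite (bounded_solutionE Sy r0).
  rewrite -(riemann_int_linear e_basis (A_linear A) (bounded_solution_cont Sy) r0).
  by rewrite (riemann_int_cst (v := A (y 0)) e_basis)// => w /andP[w0 _]; exact: zE.
rewrite zE//; apply: rnorm_eq0; apply/eqP; rewrite eq_le rnorm_ge0 andbT.
rewrite leNgt; apply/negP => Ay0.
have [B B0 yB] := bounded_solution_bound Sy.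
pose u : R := (2 * B + 1) / rnorm (A (y 0)).
have u0 : 0 <= u by rewrite divr_ge0 ?rnorm_ge0// addr_ge0// mulr_ge0.
have : rnorm (u%:C *: A (y 0)) <= B + B.
  have -> : u%:C *: A (y 0) = y u - y 0 by rewrite (yE u u0) addrC addKr.
  by rewrite (le_trans (rnormB _ _))// lerD// yB.
by rewrite rnormZC ger0_norm// /u divfK ?gt_eqF//; lra.
Qed.

(** With [mu != 0] the solution is [A u] for a bounded solution [u], so its
    integral [u t - u 0] is bounded. *)
Lemma mean_root mu k y : bounded_solution y ->
  iter k (shift (fun y => A \o y) mu) y = 0 ->
  t^-1%:C *: riemann_int 0 t y @[t --> +oo%R] --> (if mu == 0 then y 0 else 0).
Proof.
move=> Sy yk; apply/cvg_rnormP => d d0.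
have [mu0|mu0] := eqVneq mu 0.
  have yE : forall t, 0 <= t -> y t = y 0.
    apply: (@nilpotent_solution_const k) => // t _.
    by rewrite -mu0 -iter_shift_comp yk.
  near=> t.
  have t0 : 0 < t by near: t; exact: nbhs_pinfty_gt (num_real _).
  rewrite (riemann_int_cst (v := y 0) e_basis) ?(ltW t0)//.
  - by rewrite scalerA -rmorphM mulVf ?gt_eqF// scale1r subrr rnorm0.
  - exact: bounded_solution_cont.
  - by move=> u /andP[u0 _]; exact: yE.
have [u [Su _ yE]] := shift_root_onto comp_linear bounded_solution_linear
  bounded_solution_A mu0 Sy yk.
have {}yE : y = A \o u by rewrite yE /shift scale0r subr0.
have [B B0 uB] := bounded_solution_bound Su.
near=> t.
have t0 : 0 < t by near: t; exact: nbhs_pinfty_gt (num_real _).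
have tB : 2 * B / d < t by near: t; exact: nbhs_pinfty_gt (num_real _).
rewrite subr0 yE (riemann_int_linear e_basis (A_linear A)) ?(ltW t0)//; last first.
  exact: bounded_solution_cont.
have -> : A (riemann_int 0 t u) = u t - u 0.
  by rewrite (bounded_solutionE Su (ltW t0)) addrC addKr.
rewrite rnormZC ger0_norm ?invr_ge0 ?(ltW t0)// ltr_pdivrMl//.
rewrite ltr_pdivrMr// in tB; apply: le_lt_trans tB.
by rewrite (le_trans (rnormB _ _))// mulr2n mulrDl mul1r lerD// uB// ltW.
Unshelve. all: by end_near. Qed.

(** The increment is [A] applied to an integral of [y], and [y] is Lipschitz
    because [A y] is bounded. *)
Lemma solution_increment y : bounded_solution y ->
  exists2 C : R, 0 <= C & forall t h, 0 <= t -> 0 <= h ->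
    rnorm (y (t + h) - y t - h%:C *: A (y t)) <= C * h ^+ 2.
Proof.
move=> Sy; have [B B0 yB] := bounded_solution_bound Sy.
have yc := bounded_solution_cont Sy.
have [a a0 Aa] := linear_bounded e_basis (A_linear A).
have [K K0 HK] := riemann_int_primitive e_basis.
pose L := a * (K * B).
have yL s t : 0 <= s -> s <= t -> rnorm (y t - y s) <= L * (t - s).
  move=> s0 st; have t0 := le_trans s0 st.
  rewrite (bounded_solutionE Sy s0) (bounded_solutionE Sy t0).
  rewrite opprD addrACA subrr add0r -linearB (le_trans (Aa _))//.
  rewrite /L -mulrA ler_wpM2l// mulrAC.
  have := HK y yc s t 0 B s0 st; rewrite scaler0 subr0; apply => u /andP[su _].
  by rewrite subr0 yB// (le_trans s0).
have L0 : 0 <= L by rewrite !mulr_ge0.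
exists (a * (K * L)) => [|t h t0 h0]; first by rewrite !mulr_ge0.
have th : t <= t + h by rewrite lerDl.
have th0 : 0 <= t + h by rewrite addr_ge0.
rewrite {1}(bounded_solutionE Sy t0) (bounded_solutionE Sy th0).
rewrite opprD addrACA subrr add0r -linearB -linearZ -linearB (le_trans (Aa _))//.
rewrite -mulrA ler_wpM2l//.
have := HK y yc t (t + h) (y t) (L * h) t0 th.
have -> : t + h - t = h by rewrite addrC addKr.
have -> : K * L * h ^+ 2 = K * h * (L * h) by ring.
apply => u /andP[tu uth]; rewrite (le_trans (yL _ _ t0 tu))// ler_wpM2l//.
by rewrite lerBlDl.
Qed.

(** The square of the modulus is [1 + 2 h Re mu + h^2 |mu|^2], and the square
    root of [1 + x] is at most [1 + x / 2]. *)
Lemma rnorm_1DM_le (h : R) mu : 0 <= h ->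
  rnorm (1 + h%:C * mu) <= 1 + h * complex.Re mu + h ^+ 2 * rnorm mu ^+ 2 / 2.
Proof.
move=> h0; set q := 1 + _ + _.
have m2 := rnorm_sqr mu.
have q0 : 0 <= q.
  have -> : q = ((1 + h * complex.Re mu) ^+ 2 + 1 + h ^+ 2 * complex.Im mu ^+ 2) / 2.
    by rewrite /q m2; field.
  rewrite -exprMn; apply: divr_ge0 => //.
  by apply: addr_ge0; [apply: addr_ge0|]; rewrite ?sqr_ge0.
rewrite -(@ler_pXn2r _ 2) ?nnegrE ?rnorm_ge0// rnorm_sqr.
have -> : complex.Re (1 + h%:C * mu) = 1 + h * complex.Re mu.
  by case: (mu) => ? ? /=; ring.
have -> : complex.Im (1 + h%:C * mu) = h * complex.Im mu.
  by case: (mu) => ? ? /=; ring.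
have : 0 <= (q - 1) ^+ 2 by exact: sqr_ge0.
by rewrite /q m2; lra.
Qed.

(** Along the modulus of [y], the equation [y' = mu y + z] with [z] tending to
    zero expands or contracts according to the sign of [Re mu]. *)
Lemma solution_decay mu k y : complex.Re mu != 0 -> bounded_solution y ->
  iter k (shift (fun y => A \o y) mu) y = 0 ->
  forall eps : R, 0 < eps -> exists T, forall t, T <= t -> rnorm (y t) <= eps.
Proof.
move=> mu0; elim: k y => [|k IH] y Sy.
  by move=> /= -> eps e0; exists 0 => t _; rewrite rnorm0 ltW.
rewrite iterSr => zk; set z := shift _ mu y in zk.
have Sz : bounded_solution z.
  exact: (subspace_shift bounded_solution_linear bounded_solution_A).
have z0 eps : 0 < eps -> exists2 T, 0 <= T &
    forall t, T <= t -> rnorm (z t) <= eps.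
  move=> /(IH z Sz zk)[T HT]; exists (Num.max T 0); first by rewrite le_max lexx orbT.
  by move=> t; rewrite ge_max => /andP[/HT].
have [B B0 yB] := bounded_solution_bound Sy.
have [C C0 HC] := solution_increment Sy.
have yE t h : y (t + h) - (1 + h%:C * mu) *: y t =
    h%:C *: z t + (y (t + h) - y t - h%:C *: A (y t)).
  rewrite [RHS]addrC /z /shift -[(_ - mu *: y) t]/(A (y t) - mu *: y t).
  by rewrite scalerBr addrA subrK scalerDl scale1r scalerA opprD addrA.
have close eps t h : 0 <= t -> 0 <= h -> rnorm (z t) <= eps ->
    rnorm (y (t + h) - (1 + h%:C * mu) *: y t) <= h * eps + C * h ^+ 2.
  move=> t0 h0 zt; rewrite yE (le_trans (rnormD _ _))// lerD ?HC//.
  by rewrite rnormZC ger0_norm// ler_wpM2l.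
have g0 t : 0 <= t -> 0 <= rnorm (y t) by rewrite rnorm_ge0.
have [mu_lt0|mu_gt0|/esym/eqP] := ltgtP (complex.Re mu) 0;
  last by rewrite eq_sym (negPf mu0).
- have a0 : 0 < - complex.Re mu by rewrite oppr_gt0.
  pose C' := C + rnorm mu ^+ 2 / 2 * B.
  have C'0 : 0 <= C' by rewrite addr_ge0// mulr_ge0// divr_ge0// exprn_ge0// rnorm_ge0.
  apply: (decay_of_contraction a0 C'0 g0 yB) => eps e0.
  have [T T0 HT] := z0 _ e0; exists T => // t h Tt /andP[h0 h1].
  have t0 := le_trans T0 Tt.
  have := close eps t h t0 (ltW h0) (HT t Tt).
  have := rnormD (y (t + h) - (1 + h%:C * mu) *: y t) ((1 + h%:C * mu) *: y t).
  rewrite subrK rnormZ.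
  have := ler_wpM2r (rnorm_ge0 (y t)) (rnorm_1DM_le mu (ltW h0)).
  have : h ^+ 2 * rnorm mu ^+ 2 / 2 * rnorm (y t) <= h ^+ 2 * rnorm mu ^+ 2 / 2 * B.
    by rewrite ler_wpM2l ?yB// divr_ge0// mulr_ge0// exprn_ge0 ?rnorm_ge0// ltW.
  by rewrite /C'; lra.
- apply: (decay_of_expansion mu_gt0 C0 yB) => eps e0.
  have [T T0 HT] := z0 _ e0; exists T => // t h Tt /andP[h0 h1].
  have t0 := le_trans T0 Tt.
  have := close eps t h t0 (ltW h0) (HT t Tt).
  have := rnormD (y (t + h)) ((1 + h%:C * mu) *: y t - y (t + h)).
  rewrite subrKC rnormZ rdistC.
  have : (1 + h * complex.Re mu) * rnorm (y t) <= rnorm (1 + h%:C * mu) * rnorm (y t).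
    rewrite ler_wpM2r ?rnorm_ge0//.
    have -> : 1 + h * complex.Re mu = complex.Re (1 + h%:C * mu).
      by case: (mu) => ? ? /=; ring.
    by rewrite (le_trans (ler_norm _)) ?Re_le_rnorm.
  lra.
Qed.

(** An imaginary [mu != 0] is in the resolvent set, where [A - mu] is injective
    and [y] vanishes. *)
Lemma limit_root mu k y :
  (forall w : R, w != 0 -> ~ spectrum A (w *i)) -> bounded_solution y ->
  iter k (shift (fun y => A \o y) mu) y = 0 ->
  y t @[t --> +oo%R] --> (if mu == 0 then y 0 else 0).
Proof.
move=> imA Sy yk; apply/cvg_rnormP => d d0.
have yk' t : iter k (shift A mu) (y t) = 0 by rewrite -iter_shift_comp yk.
have [mu0|mu0] := eqVneq mu 0.
  have yE : forall t, 0 <= t -> y t = y 0.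
    by apply: (@nilpotent_solution_const k) => // t _; rewrite -mu0.
  near=> t; have t0 : 0 <= t by near: t; exact: nbhs_pinfty_ge (num_real _).
  by rewrite (yE t t0) subrr rnorm0.
have [re0|re0] := eqVneq (complex.Re mu) 0; last first.
  have d20 : 0 < d / 2 by rewrite divr_gt0.
  have [T HT] := solution_decay re0 Sy yk d20.
  near=> t; have Tt : T <= t by near: t; exact: nbhs_pinfty_ge (num_real _).
  rewrite subr0 (le_lt_trans (HT t Tt))//.
  by rewrite [ltRHS](splitr d) ltrDl.
have muA : resolvent_set A mu.
  apply: contrapT; have -> : mu = (complex.Im mu) *i.
    by move: re0; case: (mu) => ? ? /= ->.
  by apply: imA; apply: contraNneq mu0 => im0; rewrite eq_complex re0 im0 !eqxx.
have y0 t : y t = 0.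
  have := yk' t; elim: k {yk yk'} => [//|k IH].
  by rewrite iterS => /(resolvent_set_inj muA).
by near=> t; rewrite y0 subrr rnorm0.
Unshelve. all: by end_near. Qed.

End BoundedSolutions.

Theorem theorem4p1 (R : realType) (X : completeNormedModType R[i])
    (n : nat) (e : 'I_n -> X) (n_gt0 : (0 < n)%N) (e_basis : is_basis e)
    (A : {linear X -> X}) :
  (forall y : R -> X, weak_solution A y -> bounded_on_halfline y ->
     t^-1%:C *: riemann_int 0 t y @[t --> +oo%R] --> spectral_projection A 0 (y 0)) /\
  ((forall w : R, w != 0 -> ~ spectrum A (w *i)) ->
   forall y : R -> X, weak_solution A y -> bounded_on_halfline y ->
     y t @[t --> +oo%R] --> spectral_projection A 0 (y 0)).
Proof.
have P_root mu k (y : R -> X) : iter k (shift (fun y => A \o y) mu) y = 0 ->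
    spectral_projection A 0 (y 0) = if mu == 0 then y 0 else 0.
  move=> yk; apply: (spectral_projection_root e_basis n_gt0 (k := k)).
  by rewrite -iter_shift_comp yk.
have W_linear := @bounded_solution_linear _ _ _ _ e_basis A.
split=> [|imA] y ws bd.
- elim: (solution_root_span e_basis n_gt0 (conj ws bd)) =>
      [mu k u Su uk|u v Su IHu Sv IHv].
    by rewrite (P_root _ _ _ uk); exact: (mean_root e_basis Su uk).
  rewrite (spectral_projectionD e_basis _ n_gt0).
  apply: (cvg_trans _ (cvgD IHu IHv)); apply: near_eq_cvg.
  near=> t; have t0 : 0 <= t by near: t; exact: nbhs_pinfty_ge (num_real _).
  rewrite -[LHS]/(t^-1%:C *: riemann_int 0 t u + t^-1%:C *: riemann_int 0 t v).
  rewrite -scalerDr -(riemann_intD e_basis)//.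
  + exact: bounded_solution_cont (root_span_W W_linear Su).
  + exact: bounded_solution_cont (root_span_W W_linear Sv).
- elim: (solution_root_span e_basis n_gt0 (conj ws bd)) =>
      [mu k u Su uk|u v _ IHu _ IHv].
    by rewrite (P_root _ _ _ uk); exact: (limit_root e_basis imA Su uk).
  by rewrite (spectral_projectionD e_basis _ n_gt0); exact: cvgD.
Unshelve. all: by end_near. Qed.
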